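(* Let $\ell\in\{2,\dots,n\}$, let $G\subset S_n$ be a group of permutations with $\ell$-local base $\mathcal T$, and let $\mu\in\mathcal P(G)$ be a measure of the set $\mathcal M_{\mathcal T}$. Assume that one of the following two conditions holds, and define $c(\ell)^2$ accordingly: (i) $\mu=\mu_o$ is the uniform law of an $\ell$-local group $G$; then $c(\ell)^2=2(\ell-1)^2+2$; (ii) $G$ is a normal subgroup of $S_n$ and $\mu(\sigma)=\mu(\sigma^{-1})$ and $\mu(\sigma)=\mu(t^{-1}\sigma t)$ for all $\sigma\in G$, $t\in S_n$; then $c(\ell)^2=8(\ell-1)^2+2$. Then, for all $A\subset G$ and all $\alpha\in(0,1)$, $$\int e^{\frac{\alpha}{2c(\ell)^2}f(\sigma,A)}\,d\mu(\sigma)\le\frac{1}{\mu(A)^{\alpha/(1-\alpha)}}.$$ As a consequence, for any $\alpha\in(0,1)$ and all $t\ge0$, $$\mu\big(\{\sigma\in G:f(\sigma,A)\ge t\}\big)\le\frac{e^{-\frac{\alpha t}{2c(\ell)^2}}}{\mu(A)^{\alpha/(1-\alpha)}}.$$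
   Context: Groups. Let $n\ge2$, $[n]=\{1,\dots,n\}$, and let $S_n$ be the symmetric group on $[n]$, products being compositions: $(\sigma\tau)(i)=\sigma(\tau(i))$. A group of permutations $G$ is a subgroup of $S_n$; $\mathcal P(\cdot)$ denotes the set of probability measures. $\mathrm{supp}(\sigma)=\{i\in[n]:\sigma(i)\ne i\}$ and $\deg(\sigma)=\#\,\mathrm{supp}(\sigma)$. $G$ is $\ell$-local if for any $\sigma\in G$ and any $i,j\in[n]$ with $\sigma(i)=j$ there exists $\tau\in G$ such that $\mathrm{supp}(\tau)\subset\mathrm{supp}(\sigma)$, $\deg(\tau)\le\ell$ and $\tau(i)=j$. $G$ is normal in $S_n$ if $t^{-1}Gt=G$ for all $t\in S_n$. Local bases. Put $G_n:=G$ and, for $j\in[n-1]$, $G_j:=\{\sigma\in G:\sigma(j+1)=j+1,\dots,\sigma(n)=n\}$; $O_j:=\{\sigma(j):\sigma\in G_j\}$. A family $\mathcal T=(t_{i_j,j})$ of elements of $G$, indexed by $j\in\{2,\dots,n\}$ and $i_j\in O_j$, is an $\ell$-local base of $G$ if for every $j$ one has $t_{j,j}=\mathrm{id}$ and for every $i_j\in O_j$ with $i_j\neq j$: $t_{i_j,j}\in G_j$, $t_{i_j,j}(i_j)=j$ and $\deg(t_{i_j,j})\le\ell$. Let $U_{\mathcal T}:O_2\times\cdots\times O_n\to G$, $U_{\mathcal T}(i_2,\dots,i_n)=t_{i_2,2}t_{i_3,3}\cdots t_{i_n,n}$. The set $\mathcal M_{\mathcal T}$ consists of all push-forward measures $U_{\mathcal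 T}\#\hat\nu$ with $\hat\nu=\hat\nu_2\otimes\cdots\otimes\hat\nu_n$, $\hat\nu_j\in\mathcal P(O_j)$. Talagrand's convex-hull quantity. For $A\subset G$ and $\sigma\in G$, let $V(\sigma,A)\subset\mathbb R^n$ be the set of vectors $(\mathbf 1_{\sigma(j)\ne y(j)})_{j\in[n]}$, $y\in A$, and let $\mathrm{conv}(V(\sigma,A))$ be its convex hull, i.e. the set of $x\in\mathbb R^n$ such that for some $p\in\mathcal P(A)$, $x_j=\int\mathbf 1_{\sigma(j)\ne y(j)}\,dp(y)$ for all $j$. Then $f(\sigma,A)=\inf\{\|x\|_2^2:x\in\mathrm{conv}(V(\sigma,A))\}$ with $\|x\|_2^2=\sum_{i=1}^nx_i^2$. (If $\mu(A)=0$ the right-hand sides are $+\infty$.) *)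

(* Defs.v *)
From HB Require Import structures.
From mathcomp Require Import all_boot all_order all_algebra all_fingroup.
From mathcomp Require Import all_classical all_reals all_analysis.

Set Implicit Arguments.
Unset Strict Implicit.
Unset Printing Implicit Defensive.

Import Order.TTheory GRing.Theory Num.Theory.

Local Open Scope ring_scope.

(* The set [n] = {1, ..., n} is rendered by 'I_n = {0, ..., n-1}: the index j  *)
(* in [n] is the ordinal of value j - 1.                                       *)

(* Probability measures on a subset D of a finite type, as mass functions.     *)
Definition is_prob (R : realType) (T : finType) (D : {set T})
    (p : {ffun T -> R}) : Prop :=
  [/\ forall x, 0 <= p x,
      forall x, x \notin D -> p x = 0
    & \sum_x p x = 1].

Definition meas (R : realType) (T : finType) (p : {ffun T -> R})
    (A : {set T}) : R :=
  \sum_(x in A) p x.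

Definition pushforward (R : realType) (T T' : finType) (f : T -> T')
    (p : {ffun T -> R}) : {ffun T' -> R} :=
  [ffun y => \sum_(x | f x == y) p x].

Definition product_law (R : realType) (I T : finType)
    (p : I -> {ffun T -> R}) : {ffun {ffun I -> T} -> R} :=
  [ffun u : {ffun I -> T} => \prod_i p i (u i)].

Definition uniform_law (R : realType) (T : finType) (D : {set T}) :
    {ffun T -> R} :=
  [ffun x => if x \in D then #|D|%:R^-1 else 0].

Definition psupp (n : nat) (s : 'S_n) : {set 'I_n} := [set i | s i != i].

Definition pdeg (n : nat) (s : 'S_n) : nat := #|psupp s|.

Definition local_group (n l : nat) (G : {group 'S_n}) : Prop :=
  forall (s : 'S_n) (i j : 'I_n), s \in G -> s i = j ->
  exists2 t : 'S_n, t \in G & [/\ psupp t \subset psupp s,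
                                  (pdeg t <= l)%N
                                & t i = j].

Definition stab_above (n : nat) (G : {group 'S_n}) (j : 'I_n) : {set 'S_n} :=
  [set s in G | [forall k : 'I_n, (j < k)%N ==> (s k == k)]].

Definition orb (n : nat) (G : {group 'S_n}) (j : 'I_n) : {set 'I_n} :=
  [set s j | s : 'S_n in stab_above G j].

(* The range {2, ..., n} of the index j of a local base.                       *)
Definition base_idx (n : nat) : finType := {j : 'I_n | (0 < j)%N}.

Lemma val_enum_base_idx (n : nat) :
  [seq val j | j <- enum (base_idx n)] = [seq j : 'I_n <- enum 'I_n | (0 < j)%N].
Proof.
have -> : enum (base_idx n) = pmap insub (enum 'I_n).
  by rewrite !enumT [@Finite.enum in LHS]unlock.
rewrite pmap_filter; last exact: insubK.
by apply: eq_filter => j; apply: isSome_insub.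
Qed.

(* The element t_{i, j} is [t j i]; it is meaningful only for i in orb G j.    *)
Definition local_base (n l : nat) (G : {group 'S_n})
    (t : base_idx n -> 'I_n -> 'S_n) : Prop :=
  forall j : base_idx n,
    t j (val j) = 1%g /\
    (forall i : 'I_n, i \in orb G (val j) -> i != val j ->
       [/\ t j i \in stab_above G (val j),
           t j i i = val j
         & (pdeg (t j i) <= l)%N]).

(* Products of permutations are meant as compositions (st)(i) = s(t(i)),       *)
(* whereas (s * t)%g i = t (s i) (permM). Hence t_{i_2,2} t_{i_3,3} ... t_{i_n,n} *)
(* is the product in decreasing order of j, i.e. along [rev (enum _)].         *)
Definition base_map (n : nat) (t : base_idx n -> 'I_n -> 'S_n)
    (u : {ffun base_idx n -> 'I_n}) : 'S_n :=
  (\prod_(j <- rev (enum (base_idx n))) t j (u j))%g.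

(* The set M_T. Each nu_j is carried by O_j, so that the product law is        *)
(* carried by O_2 x ... x O_n.                                                 *)
Definition base_measure (R : realType) (n : nat) (G : {group 'S_n})
    (t : base_idx n -> 'I_n -> 'S_n) (mu : {ffun 'S_n -> R}) : Prop :=
  exists2 nu : base_idx n -> {ffun 'I_n -> R},
    forall j, is_prob (orb G (val j)) (nu j)
  & mu = pushforward (base_map t) (product_law nu).

Definition diff_vec (R : realType) (n : nat) (s y : 'S_n) : 'rV[R]_n :=
  \row_j (s j != y j)%:R.

Definition conv_diff (R : realType) (n : nat) (s : 'S_n) (A : {set 'S_n}) :
    set 'rV[R]_n :=
  [set x : 'rV[R]_n | exists2 p : {ffun 'S_n -> R},
     is_prob A p & x = \sum_(y in A) p y *: diff_vec R s y]%classic.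

Arguments conv_diff R {n} s A.

Definition sqnorm2 (R : realType) (n : nat) (x : 'rV[R]_n) : R :=
  \sum_(i < n) x ord0 i ^+ 2.

(* An extended real, so that the infimum is +oo when A is empty.               *)
Definition talagrand (R : realType) (n : nat) (s : 'S_n) (A : {set 'S_n}) :
    \bar R :=
  ereal_inf [set (sqnorm2 x)%:E | x in conv_diff R s A]%classic.

(* Main.v *)
(* Talagrand's induction for the symmetric group. Fix the values of the        *)
(* permutations on a set D of positions and argue by downward induction on     *)
(* #|D|. The induction hypothesis is an exponential bound for the cost         *)
(* sum_i x_i^2 + x_l^2, in which one coordinate is counted twice: either a     *)
(* fixed position l, or the position l = s^-1 v of a fixed value v. These two  *)
(* forms are exchanged by s |-> s^-1. To prove the second form for v, split    *)
(* according to i = s^-1 v, and let k be the fibre where A has the largest     *)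
(* density. A permutation s in the fibre i is compared with fibre i itself,    *)
(* with weight th, and with fibre k through g * s, where g k = i and g moves   *)
(* at most M positions K besides i. In fibre i one averages the kernels given  *)
(* by the first form for the l in K; the doubled coordinates absorb the        *)
(* cross terms on K at the price 2 M^2 (1 - th)^2, and the doubled coordinate  *)
(* i costs 2 (1 - th)^2, whence c^2 = 2 M^2 + 2. Hoelder's inequality and an   *)
(* optimal choice of th conclude. In case (i) locality gives M = l - 1; in     *)
(* case (ii) conjugation brings v and the values on D to the top of [n], where *)
(* g = U^-1 t_i^-1 t_k U is read off the local base and M = 2 (l - 1).         *)

Require Import Defs.
From HB Require Import structures.
From mathcomp Require Import all_boot all_order all_algebra all_fingroup.
From mathcomp Require Import all_classical all_reals all_analysis.
From mathcomp Require Import ring lra.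

Set Implicit Arguments.
Unset Strict Implicit.
Unset Printing Implicit Defensive.

Import Order.TTheory GRing.Theory Num.Theory.

Local Open Scope ring_scope.

(** A law on [A] chosen for each [s] gives a point of the convex hull, whose coordinates are the
    mismatch probabilities. It therefore suffices to build a kernel with a small exponential moment
    ([exp_bound]), recursively over cylinders.

    The heart is [switch_bound]: a fibre where [A] is sparse borrows, after a move of few
    coordinates, the kernel of the fibre where [A] is densest. Staying in the fibre is paid in
    density, borrowing by at most [a / 2 * (1 - th) ^+ 2] in the exponent, and [mixing_parameter]
    balances the two. The outcome is affine in the mass of [A] in the fibre, so the fibres can be
    summed in [exp_bound_step].

    Doubling a coordinate is what lets [cost_mixture_le] absorb the cross terms, and the doubled
    cost still dominates the squared norm. The step assumes bounds with a fixed doubled position and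
    proves one with the position of a fixed value; [exp_bound_inv] closes this loop in
    [exp_bound_cylinder].

    The local structure enters through [switchable], proved by [switchable_uniform] and
    [switchable_base_measure] for the two kinds of measure. *)

(** * Scalar exponential inequalities and Hoelder's inequality *)

Lemma expR_quadratic_le (R : realType) (a L : R) :
  0 < a < 1 -> 0 <= L <= 1 - a ->
  expR (a / (1 - a) * (L - L ^+ 2 / (2 * (1 - a))))
    <= 1 + a / (1 - a) * (1 - expR (- L)).
Proof.
move=> /andP[a0 a1] /andP[L0 L1].
have c0 : 0 < 1 - a by lra.
set b := a / (1 - a).
have b0 : 0 < b by rewrite divr_gt0.
pose E x : R := b * (x - x ^+ 2 / (2 * (1 - a))).
(* The claim is [1 <= f L]. Here [f 0 = 1], and with [u = expR (- x)] the derivative has the sign of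
   [x * (1 - a * u) - (1 - a) * (1 - u)], which is nonnegative because [1 - u <= x] and [u <= 1]. *)
pose f x : R := (1 + b * (1 - expR (- x))) * expR (- E x).
have df (x : R) : is_derive x 1 f (b * expR (- x) * expR (- E x)
    + (1 + b * (1 - expR (- x))) * (- (b * (1 - x / (1 - a))) * expR (- E x))).
  rewrite /f /E; apply: is_derive_eq.
  rewrite /GRing.scale /=.
  set u := expR (- x). set v := expR (- (b * _)).
  by field; rewrite gt_eqF.
suff : 1 <= f L.
  rewrite /f (expRN (E L)) => h; have := expR_gt0 (E L) => e0.
  by rewrite -[leLHS]mul1r -/(E L) -ler_pdivlMr.
have -> : 1 = f 0.
  by rewrite /f /E oppr0 expR0 expr0n /= !mul0r !subrr mulr0 oppr0 expR0 addr0 mulr1.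
apply: (@ger0_derive1_ndecr R f 0 (1 - a)) => //.
- move=> x; rewrite in_itv /= => /andP[x0 x1].
  rewrite derive1E (@derive_val _ _ _ _ _ _ _ (df x)).
  have := expR_gt0 (- E x); set v := expR (- E x) => v0.
  have : 1 - x <= expR (- x) by have := expR_ge1Dx (- x); lra.
  have : expR (- x) <= 1 by rewrite -expR0 ler_expR; lra.
  have := expR_gt0 (- x); set u := expR (- x) => u0 u1 u2.
  have -> : b * u * v + (1 + b * (1 - u)) * (- (b * (1 - x / (1 - a))) * v)
    = b * v * (x * (1 - a * u) - (1 - a) * (1 - u)) / (1 - a) ^+ 2.
    by rewrite /b; field; rewrite gt_eqF.
  apply: divr_ge0; last exact: sqr_ge0.
  rewrite pmulr_rge0 ?(mulr_gt0 b0 v0)// subr_ge0 mulrC; apply: ler_pM; [lra|lra|lra|nra].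
- apply: derivable_within_continuous => x _; exact: (@ex_derive _ _ _ _ _ _ _ (df x)).
Qed.

(* Optimal mixing parameter: the minimiser [1 - L / (1 - a)], [L = - ln r],   *)
(* truncated at [0].                                                          *)
Lemma mixing_parameter (R : realType) (a r : R) :
  0 < a < 1 -> 0 < r <= 1 ->
  exists2 th : R, 0 <= th <= 1 &
    expR (a / 2 * (1 - th) ^+ 2 - a / (1 - a) * th * ln r)
      <= 1 + a / (1 - a) * (1 - r).
Proof.
move=> ha; move: (ha) => /andP[a0 a1] /andP[r0 r1].
have c0 : 0 < 1 - a by lra.
have b0 : 0 < a / (1 - a) by rewrite divr_gt0.
pose L := - ln r.
have rE : r = expR (- L) by rewrite opprK lnK ?posrE.
have L0 : 0 <= L by rewrite oppr_ge0 ln_le0.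
have [L1|L1] := leP L (1 - a).
  exists (1 - L / (1 - a)).
    by rewrite subr_ge0 ler_pdivrMr// mul1r L1 /= gerBl divr_ge0// ltW.
  have := @expR_quadratic_le R a L ha; rewrite L0 L1 => /(_ isT).
  rewrite -rE; apply: le_trans; rewrite ler_expR le_eqVlt; apply/orP; left.
  apply/eqP; rewrite -[ln r]opprK -/L; field; by rewrite gt_eqF.
exists 0; first by rewrite lexx ler01.
(* At [L = 1 - a] the quadratic exponent equals [a / 2], its value for [th = 0]; the right-hand side
   only grows as [r] decreases further. *)
have := @expR_quadratic_le R a (1 - a) ha.
rewrite (ltW c0) lexx => /(_ isT).
have -> : a / (1 - a) * (1 - a - (1 - a) ^+ 2 / (2 * (1 - a)))
   = a / 2 * (1 - 0) ^+ 2 - a / (1 - a) * 0 * ln r.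
  by field; rewrite gt_eqF.
move=> h; apply: le_trans h _.
apply: lerD => //; apply: ler_wpM2l; first exact: ltW.
rewrite rE; apply: lerB => //; rewrite ler_expR lerN2; exact: ltW.
Qed.

(** The limit [r = 0] of [mixing_parameter], for fibres that [A] does not charge. *)
Lemma expR_half_le (R : realType) (a : R) :
  0 < a < 1 -> expR (a / 2) <= 1 + a / (1 - a).
Proof.
move=> /andP[a0 a1]; have c0 : 0 < 1 - a by lra.
have -> : 1 + a / (1 - a) = (1 - a)^-1 by field; rewrite gt_eqF.
rewrite -[expR _]invrK -expRN lef_pV2 ?posrE ?expR_gt0//.
by have := expR_ge1Dx (- (a / 2)); lra.
Qed.

(** The tangent line of the exponential at the mean [m] lies below its graph. *)
Lemma expR_jensen (R : realType) (J : finType) (w x : J -> R) :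
  (forall j, 0 <= w j) -> \sum_j w j = 1 ->
  expR (\sum_j w j * x j) <= \sum_j w j * expR (x j).
Proof.
move=> w0 w1; set m := \sum_j w j * x j.
have -> : expR m = \sum_j w j * (expR m * (1 + (x j - m))).
  under eq_bigr do rewrite mulrCA.
  rewrite -mulr_sumr -[LHS]mulr1; congr (_ * _).
  under eq_bigr do rewrite mulrDr mulr1 mulrBr.
  by rewrite big_split /= w1 sumrB -/m -mulr_suml w1 mul1r subrr addr0.
apply: ler_sum => j _; apply: ler_wpM2l => //.
have -> : expR (x j) = expR m * expR (x j - m) by rewrite -expRD addrC subrK.
rewrite ler_pM2l ?expR_gt0//.
exact: expR_ge1Dx.
Qed.

(** Hoelder's inequality with exponents [1 / w j]. Dividing each factor by [expR (B j)] reduces it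
    to Jensen's inequality at every [s]. *)
Lemma expR_hoelder (R : realType) (S J : finType) (H : {set S}) (m : S -> R)
    (t : R) (w : J -> R) (X : J -> S -> R) (B : J -> R) :
  0 <= t -> (forall s, 0 <= m s) -> (forall j, 0 <= w j) -> \sum_j w j = 1 ->
  (forall j, \sum_(s in H) m s * expR (X j s) <= t * expR (B j)) ->
  \sum_(s in H) m s * expR (\sum_j w j * X j s)
    <= t * expR (\sum_j w j * B j).
Proof.
move=> t0 m0 w0 w1 hB; set b := \sum_j w j * B j.
rewrite -ler_pdivrMr ?expR_gt0// -expRN mulr_suml.
have -> : t = \sum_j w j * (t * expR (B j) * expR (- B j)).
  under eq_bigr do rewrite -mulrA -expRD subrr expR0 mulr1.
  by rewrite -mulr_suml w1 mul1r.
apply: (@le_trans _ _ (\sum_j w j * ((\sum_(s in H) m s * expR (X j s)) * expR (- B j)))).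
  under [leRHS]eq_bigr do rewrite mulr_suml mulr_sumr.
  rewrite exchange_big /=; apply: ler_sum => s _.
  rewrite -mulrA -expRD.
  have -> : \sum_j w j * X j s - b = \sum_j w j * (X j s - B j).
    by rewrite /b -sumrB; apply: eq_bigr => j _; rewrite mulrBr.
  apply: le_trans (ler_wpM2l (m0 s) (expR_jensen _ w0 w1)) _.
  rewrite mulr_sumr; apply: ler_sum => j _.
  by rewrite expRD mulrCA !mulrA.
apply: ler_sum => j _; apply: ler_wpM2l => //; apply: ler_wpM2r => //.
Qed.

(** * Mismatch probabilities and the cost of a mixture *)

Definition mismatch (R : realType) (n : nat) (p : {ffun 'S_n -> R})
    (s : 'S_n) (i : 'I_n) : R :=
  \sum_y p y * (s i != y i)%:R.

Definition cost (R : realType) (n : nat) (p : {ffun 'S_n -> R}) (s : 'S_n)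
    (l : 'I_n) : R :=
  \sum_i mismatch p s i ^+ 2 + mismatch p s l ^+ 2.

Definition mixture (R : realType) (T I : finType) (th : R) (K : {set I})
    (p : I -> {ffun T -> R}) (q : {ffun T -> R}) : {ffun T -> R} :=
  [ffun y => th / #|K|%:R * (\sum_(l in K) p l y) + (1 - th) * q y].

Lemma mismatch_ge0 (R : realType) (n : nat) (A : {set 'S_n}) (p : {ffun 'S_n -> R})
    (s : 'S_n) (i : 'I_n) :
  is_prob A p -> 0 <= mismatch p s i.
Proof. by case=> p0 _ _; apply: sumr_ge0 => y _; rewrite mulr_ge0. Qed.

Lemma mismatch_le1 (R : realType) (n : nat) (A : {set 'S_n}) (p : {ffun 'S_n -> R})
    (s : 'S_n) (i : 'I_n) :
  is_prob A p -> mismatch p s i <= 1.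
Proof.
case=> p0 _ <-; apply: ler_sum => y _; rewrite -[leRHS]mulr1 ler_wpM2l//.
by case: (_ != _).
Qed.

Lemma mismatch_eq0 (R : realType) (n : nat) (A : {set 'S_n}) (p : {ffun 'S_n -> R})
    (s : 'S_n) (i : 'I_n) :
  is_prob A p -> (forall y, y \in A -> y i = s i) -> mismatch p s i = 0.
Proof.
case=> _ pA _ hA; apply: big1 => y _.
have [yA|/pA ->] := boolP (y \in A); last by rewrite mul0r.
by rewrite (hA y yA) eqxx mulr0.
Qed.

Lemma eq_mismatch (R : realType) (n : nat) (p : {ffun 'S_n -> R})
    (s s' : 'S_n) (i : 'I_n) :
  s i = s' i -> mismatch p s i = mismatch p s' i.
Proof. by move=> e; apply: eq_bigr => y _; rewrite e. Qed.

Lemma mismatch_mixture (R : realType) (n : nat) (I : finType) (th : R) (K : {set I})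
    (p : I -> {ffun 'S_n -> R}) (q : {ffun 'S_n -> R}) (s : 'S_n) (i : 'I_n) :
  mismatch (mixture th K p q) s i
    = th / #|K|%:R * (\sum_(l in K) mismatch (p l) s i) + (1 - th) * mismatch q s i.
Proof.
rewrite /mismatch; under eq_bigr do rewrite ffunE mulrDl.
rewrite big_split /=; congr (_ + _).
  under eq_bigr do rewrite -mulrA mulr_suml.
  by rewrite -mulr_sumr exchange_big.
under eq_bigr do rewrite -mulrA.
by rewrite -mulr_sumr.
Qed.

(** Expand the weighted variance around the weighted sum [m]; a total weight below 1 only helps. *)
Lemma sqr_sum_le (R : realType) (I : finType) (P : pred I) (w x : I -> R) :
  (forall i, 0 <= w i) -> \sum_(i | P i) w i <= 1 ->
  (\sum_(i | P i) w i * x i) ^+ 2 <= \sum_(i | P i) w i * x i ^+ 2.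
Proof.
move=> w0 w1; move em : (\sum_(i | P i) w i * x i) => m.
have : 0 <= \sum_(i | P i) w i * (x i - m) ^+ 2.
  by apply: sumr_ge0 => i _; rewrite mulr_ge0 ?sqr_ge0.
have -> : \sum_(i | P i) w i * (x i - m) ^+ 2
   = \sum_(i | P i) w i * x i ^+ 2 - 2 * m * m + m ^+ 2 * (\sum_(i | P i) w i).
  have -> : 2 * m * m = \sum_(i | P i) 2 * m * (w i * x i).
    by rewrite -mulr_sumr em.
  rewrite mulr_sumr -sumrB -big_split /=.
  by apply: eq_bigr => i _; ring.
have := sqr_ge0 m; nra.
Qed.

(** [None] indexes one extra term, so that [sqr_sum_le] applies to a family together with a further
    summand. *)
Lemma sum_option_cond (R : realType) (I : finType) (P : pred I) (F : option I -> R) :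
  \sum_(o | oapp P true o) F o = F None + \sum_(j | P j) F (Some j).
Proof.
rewrite (bigD1 None)//=; congr (_ + _).
rewrite (reindex_omap Some id) /=; last by case.
by apply: eq_bigl => j; rewrite eqxx !andbT.
Qed.

(* Cauchy-Schwarz with weights [th / N] on the [x j], [j != l], [th / 2N] on  *)
(* [2 x l] and [1 / 2N] on [2 N u]; their sum is at most 1.                   *)
Lemma sqr_average_add_le (R : realType) (I : finType) (K : {set I}) (l : I)
    (x : I -> R) (th u : R) :
  l \in K -> 0 <= th <= 1 -> (forall j, 0 <= x j) ->
  (th / #|K|%:R * (\sum_(j in K) x j) + u) ^+ 2
    <= th / #|K|%:R * (\sum_(j in K) x j ^+ 2 + x l ^+ 2) + 2 * #|K|%:R * u ^+ 2.
Proof.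
move=> lK /andP[th0 th1] x0.
have N0 : (0 < #|K|)%N by apply/card_gt0P; exists l.
set N : R := #|K|%:R; have N1 : 0 < N by rewrite ltr0n.
pose w (j : option I) := if j is Some j then
  if j == l then th / N / 2 else th / N else (2 * N)^-1.
pose z (j : option I) := if j is Some j then
  if j == l then 2 * x l else x j else 2 * N * u.
have thN : 0 <= th / N by rewrite divr_ge0// ltW.
have := @sqr_sum_le R (option I) (oapp (mem K) true) w z.
rewrite !sum_option_cond /=.
have E (F : I -> R) c : \sum_(j in K) (if j == l then c else F j) = c + \sum_(j in K | j != l) F j.
  by rewrite (bigD1 l)//= eqxx; congr (_ + _); apply: eq_bigr => j /andP[_ /negbTE ->].
have -> : \sum_(j in K) (if j == l then th / N / 2 else th / N) = th - th / N / 2.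
  rewrite E sumr_const; have : (#|[pred j in K | j != l]| = #|K|.-1)%N.
    rewrite (cardD1 l K) lK /=; apply: eq_card => j; by rewrite !inE andbC.
  move=> ->; rewrite -[_ *+ _.-1]mulr_natr -subn1 natrB// -/N; field; by rewrite gt_eqF.
have -> : \sum_(j in K) (if j == l then th / N / 2 else th / N) *
    (if j == l then 2 * x l else x j) = th / N * (\sum_(j in K) x j).
  rewrite mulr_sumr; apply: eq_bigr => j _; case: eqP => // ->.
  by field; rewrite gt_eqF.
have -> : \sum_(j in K) (if j == l then th / N / 2 else th / N) *
    (if j == l then 2 * x l else x j) ^+ 2
    = th / N * (\sum_(j in K) x j ^+ 2 + x l ^+ 2).
  rewrite (bigD1 l)//= eqxx (bigD1 (P := mem K) l)//=.
  rewrite -[LHS]/(th / N / 2 * (2 * x l) ^+ 2 + _).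
  under eq_bigr => j /andP[_ /negbTE ->] do over.
  rewrite -mulr_sumr; field; by rewrite gt_eqF.
have -> : (2 * N)^-1 * (2 * N * u) = u by field; rewrite gt_eqF.
have -> : (2 * N)^-1 * (2 * N * u) ^+ 2 = 2 * N * u ^+ 2 by field; rewrite gt_eqF.
move=> h; rewrite addrC [leRHS]addrC; apply: h.
  by case=> [j|]; rewrite /w; [case: ifP => _ //; rewrite divr_ge0|rewrite invr_ge0 mulr_ge0// ltW].
have -> : (2 * N)^-1 + (th - th / N / 2) = th + (1 - th) / (2 * N) by field; rewrite gt_eqF.
have : (1 - th) / (2 * N) <= 1 - th.
  have N2 : 1 <= N by rewrite ler1n.
  rewrite ler_pdivrMr ?mulr_gt0//; nra.
lra.
Qed.

Lemma costE (R : realType) (n : nat) (p : {ffun 'S_n -> R}) (s : 'S_n) (l : 'I_n) :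
  cost p s l = \sum_j (1 + (j == l)%:R) * mismatch p s j ^+ 2.
Proof.
under eq_bigr do rewrite mulrDl mul1r.
rewrite big_split /= /cost; congr (_ + _).
rewrite (bigD1 l)//= eqxx mul1r big1 ?addr0// => j /negbTE ->.
by rewrite mul0r.
Qed.

(* [s] and [g * s] differ at [i] and on [K] only. On [K] the trivial bound 1  *)
(* for the mismatch with [q] is absorbed by the doubled coordinates of the    *)
(* [p l], see sqr_average_add_le; at [i] only [q] contributes.                *)
Lemma cost_mixture_le (R : realType) (n : nat) (H A : {set 'S_n})
    (p : 'I_n -> {ffun 'S_n -> R}) (q : {ffun 'S_n -> R}) (g s : 'S_n)
    (i k : 'I_n) (th : R) (K := psupp g :\ i) :
  0 <= th <= 1 -> g k = i -> i != k ->
  (forall l, is_prob H (p l)) -> (forall y, y \in H -> y i = s i) ->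
  is_prob A q ->
  cost (mixture th K p q) s i
    <= th / #|K|%:R * (\sum_(l in K) cost (p l) s l) + (1 - th) * cost q (g * s)%g k
       + (2 * #|K|%:R ^+ 2 + 2) * (1 - th) ^+ 2.
Proof.
move=> hth gk ik hp hH hq; move: (hth) => /andP[th0 th1].
have kK : k \in K by rewrite !inE eq_sym ik gk.
have N0 : (0 < #|K|)%N by apply/card_gt0P; exists k.
have iK : i \notin K by rewrite !inE eqxx.
set N : R := #|K|%:R; have N1 : 0 < N by rewrite ltr0n.
have thN : 0 <= th / N by rewrite divr_ge0// ltW.
have u0 : 0 <= 1 - th by lra.
pose y j := mismatch (mixture th K p q) s j.
pose x l j := mismatch (p l) s j.
pose b j := mismatch q (g * s)%g j.
(* A bound for each coordinate. Summed over [j], the last two terms give [N] times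
   [2 * N * (1 - th) ^+ 2] from [K], and [2 * (1 - th) ^+ 2] from [i]: this is the constant of the
   statement. *)
pose T j := th / N * (\sum_(l in K) (1 + (j == l)%:R) * x l j ^+ 2)
  + (1 - th) * b j ^+ 2 + (j \in K)%:R * (2 * N * (1 - th) ^+ 2)
  + (j == i)%:R * (2 * (1 - th) ^+ 2).
have sK (F : 'I_n -> R) j : \sum_(l in K) (1 + (j == l)%:R) * F l
    = \sum_(l in K) F l + (j \in K)%:R * F j.
  under eq_bigr do rewrite mulrDl mul1r.
  rewrite big_split /=; congr (_ + _); have [jK|jK] := boolP (j \in K).
    rewrite (bigD1 j)//= eqxx big1 ?addr0// => l /andP[_ lj].
    by rewrite eq_sym (negbTE lj) mul0r.
  rewrite mul0r big1// => l lK; case: eqP => [jl|_]; last by rewrite mul0r.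
  by rewrite jl lK in jK.
have yT j : (1 + (j == i)%:R) * y j ^+ 2 <= T j.
  rewrite /T sK /y mismatch_mixture -/N.
  have z0 := mismatch_ge0 s j hq; have z1 := mismatch_le1 s j hq.
  have [->|ji] := eqVneq j i.
    rewrite (negbTE iK) !mul0r !addr0 mul1r.
    have -> : \sum_(l in K) mismatch (p l) s i = 0.
      by apply: big1 => l _; apply: mismatch_eq0 (hp l) hH.
    have y0 := mismatch_ge0 s i hq; have y1 := mismatch_le1 s i hq.
    rewrite mulr0 add0r.
    apply: (@le_trans _ _ (2 * (1 - th) ^+ 2)).
      rewrite exprMn -[1 + 1]/2 ler_pM2l// ler_piMr ?sqr_ge0//.
      by rewrite expr_le1.
    rewrite lerDr; apply: addr_ge0; apply: mulr_ge0 => //; last exact: sqr_ge0.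
    by apply: sumr_ge0 => l _; exact: sqr_ge0.
  rewrite mul0r !addr0 mul1r; have [jK|jK] := boolP (j \in K).
    rewrite !mul1r.
    apply: (@le_trans _ _ ((th / N * (\sum_(l in K) x l j) + (1 - th)) ^+ 2)).
      have s0 : 0 <= th / N * (\sum_(l in K) x l j).
        by apply: mulr_ge0 => //; apply: sumr_ge0 => l _; apply: mismatch_ge0 (hp l).
      apply: lerXn2r; rewrite ?nnegrE; [|exact: addr_ge0|].
        by apply: addr_ge0 => //; exact: mulr_ge0.
      by rewrite lerD2l ler_piMr.
    have := @sqr_average_add_le R _ K j (fun l => x l j) th (1 - th) jK hth
      (fun l => mismatch_ge0 s j (hp l)).
    rewrite -/N => h; apply: le_trans h _; rewrite lerD2r lerDl.
    by rewrite mulr_ge0 ?sqr_ge0.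
  rewrite !mul0r !addr0.
  (* Off [K] and [i] nothing is moved, so [s] and [g * s] agree at [j] and convexity of the square
     suffices. *)
  have gj : g j = j.
    by move: jK; rewrite !inE ji /= negbK => /eqP.
  have -> : mismatch q s j = b j by apply: eq_mismatch; rewrite permM gj.
  pose w (o : option 'I_n) := if o is Some l then th / N else 1 - th.
  pose z (o : option 'I_n) := if o is Some l then x l j else b j.
  have := @sqr_sum_le R (option 'I_n) (oapp (mem K) true) w z.
  rewrite !sum_option_cond /= -!mulr_sumr => h.
  rewrite [in leLHS]addrC [leRHS]addrC; apply: h.
    by case.
  rewrite sumr_const.
  have -> : 1 - th + th * (N^-1 *+ #|K|) = 1.
    by rewrite -[_ *+ #|_|]mulr_natr -/N; field; rewrite gt_eqF.
  exact: lexx.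
rewrite costE; apply: le_trans (ler_sum _ (fun j _ => yT j)) _.
have -> : \sum_(l in K) cost (p l) s l
    = \sum_(l in K) \sum_j (1 + (j == l)%:R) * x l j ^+ 2.
  by apply: eq_bigr => l _; rewrite costE.
rewrite /T 3!big_split /= -mulr_sumr exchange_big /= -mulr_sumr -!mulr_suml.
have -> : \sum_j (j \in K)%:R = N :> R.
  by rewrite /N -sumr_const [RHS]big_mkcond; apply: eq_bigr => j _; case: (j \in K).
have -> : \sum_j (j == i)%:R = 1 :> R.
  by rewrite (bigD1 i)//= eqxx big1 ?addr0// => j /negbTE ->.
set S1 := \sum_(l in K) _; set S2 := \sum_j _.
have : (1 - th) * S2 <= (1 - th) * cost q (g * s)%g k.
  by apply: ler_wpM2l => //; rewrite /cost lerDl sqr_ge0.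
set Q := cost q _ _; move: S1 S2 Q => S1 S2 Q; nra.
Qed.

(** * Exponential bounds and the comparison of two fibres *)

(** The exponential moment conditioned on [C] is at most the conditional probability of [A] to the
    power [- b]. Letting [l] depend on [s] covers both forms of the induction. *)
Definition exp_bound (R : realType) (n : nat) (mu : {ffun 'S_n -> R}) (kap b : R)
    (C A : {set 'S_n}) (l : 'S_n -> 'I_n) : Prop :=
  exists2 p : 'S_n -> {ffun 'S_n -> R},
    forall s, is_prob (A :&: C) (p s)
  & \sum_(s in C) mu s * expR (kap * cost (p s) s (l s))
      <= meas mu C * expR (- b * ln (meas mu (A :&: C) / meas mu C)).

Lemma sum_option (R : realType) (I : finType) (F : option I -> R) :
  \sum_o F o = F None + \sum_j F (Some j).
Proof.
by rewrite -(sum_option_cond predT); apply: eq_bigl; case.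
Qed.

Lemma is_prob_subset (R : realType) (T : finType) (A B : {set T}) (p : {ffun T -> R}) :
  A \subset B -> is_prob A p -> is_prob B p.
Proof.
move=> AB [p0 pA p1]; split=> // x xB; apply: pA.
by apply: contra xB; exact: fintype.subsetP AB x.
Qed.

Lemma is_prob_dirac (R : realType) (T : finType) (A : {set T}) (x : T) :
  x \in A -> is_prob A [ffun y => (y == x)%:R : R].
Proof.
move=> xA; split=> [y|y yA|]; rewrite ?ffunE //.
  by case: eqP => // yx; rewrite yx xA in yA.
under eq_bigr do rewrite ffunE.
by rewrite (bigD1 x)//= eqxx big1 ?addr0// => y /negbTE ->.
Qed.

Lemma is_prob_mixture (R : realType) (T I : finType) (A : {set T}) (th : R)
    (K : {set I}) (p : I -> {ffun T -> R}) (q : {ffun T -> R}) :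
  0 <= th <= 1 -> (0 < #|K|)%N -> (forall l, is_prob A (p l)) -> is_prob A q ->
  is_prob A (mixture th K p q).
Proof.
move=> /andP[th0 th1] N0 hp [q0 qA q1].
have N1 : 0 < #|K|%:R :> R by rewrite ltr0n.
split=> [x|x xA|].
- rewrite ffunE addr_ge0 ?mulr_ge0 ?divr_ge0 ?subr_ge0//.
  by apply: sumr_ge0 => l _; case: (hp l).
- rewrite ffunE qA// big1 ?mulr0 ?addr0// => l _.
  by case: (hp l) => _ -> .
under eq_bigr do rewrite ffunE.
rewrite big_split /= -!mulr_sumr q1 exchange_big /=.
have -> : \sum_(l in K) \sum_x p l x = #|K|%:R.
  by rewrite -sumr_const; apply: eq_bigr => l _; case: (hp l).
by field; rewrite gt_eqF.
Qed.

(** On [H] the kernel mixes those of [H] with the kernel [q] of [H'] read through [g]. [P] is the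
    reference density of [A], and the ratio [x / m / P] governs the mixing weight. *)
Lemma switch_bound (R : realType) (n M : nat) (mu : {ffun 'S_n -> R})
    (a : R) (A H H' : {set 'S_n}) (q : 'S_n -> {ffun 'S_n -> R}) (g : 'S_n)
    (i k v : 'I_n) (r P : R)
    (b := a / (1 - a)) (kap := a / (2 * (2 * M%:R ^+ 2 + 2)))
    (m := meas mu H) (x := meas mu (A :&: H)) :
  0 < a < 1 -> (forall s, 0 <= mu s) -> g k = i -> i != k ->
  (#|psupp g :\ i| <= M)%N -> 0 < r -> (forall s, s \in H -> s i = v) ->
  (forall s, ((g * s)%g \in H') = (s \in H)) ->
  (forall s, s \in H -> mu (g * s)%g = r * mu s) ->
  0 < m -> 0 < P -> x / m <= P ->
  (0 < x -> forall l, exp_bound mu kap b H A (fun=> l)) ->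
  (forall s, is_prob (A :&: H') (q s)) ->
  \sum_(s in H') mu s * expR (kap * cost (q s) s k) <= meas mu H' * expR (- b * ln P) ->
  exists2 p : 'S_n -> {ffun 'S_n -> R},
    forall s, is_prob (A :&: (H :|: H')) (p s)
  & \sum_(s in H) mu s * expR (kap * cost (p s) s i)
      <= expR (- b * ln P) * (m + b * (m - x / P)).
Proof.
move=> ha mu0 gk ik KM r0 hv gH gmu m0 P0 xP hx hq hH'.
move: (ha) => /andP[a0 a1]; have c0 : 0 < 1 - a by lra.
have b0 : 0 < b by rewrite divr_gt0.
set K := psupp g :\ i; set N := #|K|.
have c2 : 0 < 2 * M%:R ^+ 2 + 2 :> R by have := sqr_ge0 (M%:R : R); lra.
have kap0 : 0 < kap by rewrite divr_gt0// mulr_gt0.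
have kK : k \in K by rewrite !inE eq_sym ik gk.
have N0 : (0 < N)%N by apply/card_gt0P; exists k.
have kapN : kap * (2 * N%:R ^+ 2 + 2) <= a / 2.
  have -> : a / 2 = kap * (2 * M%:R ^+ 2 + 2) by rewrite /kap; field; rewrite gt_eqF.
  rewrite ler_pM2l// lerD2r ler_pM2l// ler_sqr ?nnegrE ?ler0n//.
  by rewrite ler_nat.
(* Translation by [g] carries the bound from [H'] to [H]; the factor [r] cancels. *)
have hHq : \sum_(s in H) mu s * expR (kap * cost (q (g * s)%g) (g * s)%g k)
    <= m * expR (- b * ln P).
  have mH' : meas mu H' = r * m.
    rewrite /meas (reindex_inj (mulgI g)) /= mulr_sumr.
    rewrite (eq_bigl _ _ gH); apply: eq_bigr => s sH; exact: gmu.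
  rewrite -(ler_pM2l r0) mulrA -mH'; apply: le_trans hH'.
  rewrite [leRHS](reindex_inj (mulgI g)) /= (eq_bigl _ _ gH) mulr_sumr.
  by apply: ler_sum => s sH; rewrite gmu// mulrA.
have hH y s : s \in H -> y \in H -> y i = s i by move=> sH yH; rewrite !hv.
have [x0|x0] := ltP 0 x; last first.
  (* No mass of [A] in [H]: only [q] is used, at the price [expR (a / 2)]. *)
  have {x0} xE : x = 0.
    by apply/eqP; rewrite eq_le x0; apply: sumr_ge0.
  exists (fun s => q (g * s)%g).
    by move=> s; apply: is_prob_subset (hq _); apply: finset.setIS; exact: finset.subsetUr.
  rewrite xE mul0r subr0.
  apply: (@le_trans _ _ (\sum_(s in H) mu s * expR (kap * cost (q (g * s)%g) (g * s)%g k)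
      * expR (a / 2))).
    apply: ler_sum => s sH; rewrite -mulrA -expRD ler_wpM2l// ler_expR.
    (* A Dirac mass serves as a dummy kernel of weight 0 in [cost_mixture_le]. *)
    have h1 : is_prob [set s] [ffun y => (y == s)%:R : R].
      by apply: is_prob_dirac; rewrite inE.
    have h2 y : y \in [set s] -> y i = s i by rewrite inE => /eqP ->.
    have h3 : 0 <= (0 : R) <= 1 by rewrite lexx ler01.
    have := cost_mixture_le h3 gk ik (fun=> h1) h2 (hq (g * s)%g).
    have -> : mixture 0 (psupp g :\ i) (fun=> [ffun y => (y == s)%:R])
      (q (g * s)%g) = q (g * s)%g.
      by apply/ffunP => y; rewrite ffunE !mul0r add0r subr0 mul1r.
    rewrite !mul0r add0r subr0 expr1n mul1r mulr1 -(ler_pM2l kap0) -/K -/N.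
    by move=> h; apply: le_trans h _; rewrite [leLHS]mulrDr lerD2l.
  rewrite -mulr_suml; apply: le_trans (ler_wpM2r (expR_ge0 _) hHq) _.
  have -> : m + b * m = m * (1 + b) by ring.
  rewrite [m * _]mulrC -mulrA ler_wpM2l ?expR_ge0//.
  by rewrite ler_wpM2l ?(ltW m0)//; exact: expR_half_le.
have rho0 : 0 < x / m / P by rewrite !divr_gt0.
have rho1 : x / m / P <= 1 by rewrite ler_pdivrMr// mul1r.
have := @mixing_parameter R a _ ha; move/(_ (x / m / P)).
rewrite rho0 rho1 => /(_ isT) [th hth]; rewrite -/b => hth2.
have /choice[p hp] : forall l, exists p : 'S_n -> {ffun 'S_n -> R},
    (forall s, is_prob (A :&: H) (p s)) /\
    \sum_(s in H) mu s * expR (kap * cost (p s) s l) <= m * expR (- b * ln (x / m)).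
  by move=> l; have [p h1 h2] := hx x0 l; exists p.
have th01 := hth; case/andP: th01 => th0 th1.
have thN : 0 <= th / N%:R by rewrite divr_ge0.
have N1 : 0 < N%:R :> R by rewrite ltr0n.
exists (fun s => mixture th K (fun l => p l s) (q (g * s)%g)).
  move=> s; apply: is_prob_mixture => // [l|].
    apply: is_prob_subset ((hp l).1 s); apply: finset.setIS; exact: finset.subsetUl.
  apply: is_prob_subset (hq _); apply: finset.setIS; exact: finset.subsetUr.
(* Hoelder weights: [None] stands for [q], [Some l] with [l] in [K] for the kernel with doubled
   position [l]. *)
pose w (o : option 'I_n) : R :=
  if o is Some l then if l \in K then th / N%:R else 0 else 1 - th.
pose X (o : option 'I_n) s : R :=
  if o is Some l then kap * cost (p l s) s l
  else kap * cost (q (g * s)%g) (g * s)%g k.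
pose B (o : option 'I_n) : R :=
  if o is Some l then - b * ln (x / m) else - b * ln P.
have wE (F : option 'I_n -> R) : \sum_o w o * F o
    = (1 - th) * F None + th / N%:R * (\sum_(l in K) F (Some l)).
  rewrite sum_option /= mulr_sumr [in RHS]big_mkcond; congr (_ + _).
  by apply: eq_bigr => l _; case: ifP => // _; rewrite mul0r.
have w1 : \sum_o w o = 1.
  under eq_bigr do rewrite -[w _]mulr1.
  rewrite wE sumr_const -/N; field; by rewrite gt_eqF.
have w0 o : 0 <= w o by case: o => [l|] /=; [case: ifP|rewrite subr_ge0].
have XB o : \sum_(s in H) mu s * expR (X o s) <= m * expR (B o).
  by case: o => [l|] //=; case: (hp l).
have := expR_hoelder (ltW m0) mu0 w0 w1 XB.
rewrite wE sumr_const -/N /= => hol.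
apply: (@le_trans _ _ (\sum_(s in H) (mu s * expR (\sum_j w j * X j s))
   * expR (a / 2 * (1 - th) ^+ 2))).
  apply: ler_sum => s sH; rewrite -mulrA -expRD ler_wpM2l// ler_expR wE /=.
  have hs y : y \in A :&: H -> y i = s i.
    by rewrite finset.in_setI => /andP[_ yH]; exact: hH.
  have := cost_mixture_le hth gk ik (fun l => (hp l).1 s) hs (hq (g * s)%g).
  rewrite -(ler_pM2l kap0) => h; apply: le_trans h _.
  rewrite -/K -/N -mulr_sumr.
  have : kap * (2 * N%:R ^+ 2 + 2) * (1 - th) ^+ 2 <= a / 2 * (1 - th) ^+ 2.
    by apply: ler_wpM2r => //; exact: sqr_ge0.
  set c1 := cost _ _ _; set S1 := \sum_(l in K) _; set e := a / 2.
  move: (1 - th) (th / N%:R) (2 * _ + 2) => z1 z2 z3; lra.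
rewrite -mulr_suml; apply: le_trans (ler_wpM2r (expR_ge0 _) hol) _.
have -> : m + b * (m - x / P) = m * (1 + b * (1 - x / m / P)).
  by field; rewrite !gt_eqF.
rewrite [leRHS]mulrCA -[leLHS]mulrA ler_pM2l // -expRD.
(* Writing [x / m] as [P] times the ratio splits off [- b * ln P] and leaves the exponent of
   [mixing_parameter]. *)
have -> : (1 - th) * (- b * ln P) + th / N%:R * ((- b * ln (x / m)) *+ N)
    + a / 2 * (1 - th) ^+ 2
  = - b * ln P + (a / 2 * (1 - th) ^+ 2 - b * th * ln (x / m / P)).
  rewrite (ln_div (x := x / m)) ?posrE ?divr_gt0// -[_ *+ N]mulr_natr.
  by field; rewrite gt_eqF.
by rewrite expRD ler_wpM2l ?expR_ge0.
Qed.

(** * Cylinders, switchability and inversion *)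

Definition cylinder (n : nat) (s0 : 'S_n) (D : {set 'I_n}) : {set 'S_n} :=
  [set s : 'S_n | [forall d in D, s d == s0 d]].

(* The part of [mu] living on the permutations that extend [s1] on [i |: D]   *)
(* and the one for [s2] on [k |: D] are proportional through [g], which moves *)
(* few positions besides [i]; recall that [(g * s)%g x = s (g x)].            *)
Definition switchable (R : realType) (n M : nat) (mu : {ffun 'S_n -> R}) : Prop :=
  forall (s1 s2 : 'S_n) (D : {set 'I_n}) (i k : 'I_n),
    0 < mu s1 -> 0 < mu s2 -> s2 \in cylinder s1 D -> s1 i = s2 k -> i != k ->
    exists (g : 'S_n) (r : R),
      [/\ {in D, forall d, g d = d}, g k = i, (#|psupp g :\ i| <= M)%N, 0 < r
        & forall s, s \in cylinder s1 (i |: D) -> mu (g * s)%g = r * mu s].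

Lemma in_cylinder (n : nat) (s0 s : 'S_n) (D : {set 'I_n}) :
  reflect {in D, s =1 s0} (s \in cylinder s0 D).
Proof. by rewrite inE; apply: (iffP forall_inP) => h d /h /eqP. Qed.

Lemma mem_cylinder_inv (n : nat) (s0 : 'S_n) (D : {set 'I_n}) :
  ((cylinder s0 D)^-1)%g = cylinder (s0^-1)%g (s0 @: D).
Proof.
apply/finset.setP => s; rewrite mem_invg; apply/in_cylinder/in_cylinder => h.
  by move=> _ /imsetP[d dD ->]; rewrite permK -(h d dD) permKV.
move=> d dD; have := h (s0 d) (imset_f _ dD).
by rewrite permK => e; rewrite -[d in LHS]e permK.
Qed.

Lemma meas_invg (R : realType) (n : nat) (mu : {ffun 'S_n -> R}) (A : {set 'S_n}) :
  (forall s, mu (s^-1)%g = mu s) -> meas mu (A^-1)%g = meas mu A.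
Proof.
move=> muV; rewrite /meas (reindex_inj invg_inj) /=.
by apply: eq_big => s; rewrite ?mem_invg ?invgK.
Qed.

(** [s] and [y] differ at [i] exactly when their inverses differ at [s i], up to replacing [y] by
    the value it should take back: with [p'] the image law, inversion permutes the mismatch
    coordinates by [s]. *)
Lemma exp_bound_inv (R : realType) (n : nat) (mu : {ffun 'S_n -> R}) (kap b : R)
    (C A : {set 'S_n}) (l : 'I_n) :
  (forall s, mu (s^-1)%g = mu s) ->
  exp_bound mu kap b C A (fun s => (s^-1)%g l) ->
  exp_bound mu kap b (C^-1)%g (A^-1)%g (fun=> l).
Proof.
move=> muV [p hp hb].
pose p' (s : 'S_n) : {ffun 'S_n -> R} := [ffun y => p (s^-1)%g (y^-1)%g].
have misE s i : mismatch (p' s) s i = mismatch (p (s^-1)%g) (s^-1)%g (s i).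
  rewrite /mismatch (reindex_inj invg_inj) /=; apply: eq_bigr => y _.
  rewrite ffunE invgK permK; congr (_ * (~~ _)%:R).
  by rewrite eq_sym (canF_eq (permKV y)) eq_sym.
exists p' => [s|].
  case: (hp (s^-1)%g) => p0 pA p1; split=> [y|y yA|]; rewrite ?ffunE//.
    by apply: pA; rewrite -mem_invg invIg in yA *.
  rewrite -p1 (reindex_inj invg_inj) /=.
  by apply: eq_bigr => y _; rewrite ffunE invgK.
rewrite -invIg !meas_invg//.
apply: le_trans hb; rewrite le_eqVlt; apply/orP; left; apply/eqP.
rewrite (reindex_inj invg_inj) /=; apply: eq_big => s; first by rewrite mem_invg invgK.
move=> _; rewrite muV; congr (_ * expR (_ * _)).
rewrite /cost !misE invgK; congr (_ + _).
under eq_bigr do rewrite misE invgK.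
by rewrite (reindex_inj (@perm_inj _ s)) /=; apply: eq_bigr => j _; rewrite permK.
Qed.

Lemma meas_gt0P (R : realType) (T : finType) (mu : {ffun T -> R}) (A : {set T}) :
  (forall s, 0 <= mu s) -> 0 < meas mu A -> exists2 s, s \in A & 0 < mu s.
Proof.
move=> mu0 A0; apply: contrapT => h; move: A0.
rewrite /meas big1 ?ltxx// => s sA; apply/eqP; rewrite eq_le mu0 andbT leNgt.
by apply/negP => s0; apply: h; exists s.
Qed.

Lemma meas_fibers (R : realType) (T I : finType) (mu : {ffun T -> R})
    (A : {set T}) (f : T -> I) :
  meas mu A = \sum_i meas mu [set s in A | f s == i].
Proof.
rewrite /meas (partition_big f predT)//=; apply: eq_bigr => i _.
by apply: eq_bigl => s; rewrite inE.
Qed.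

Lemma exp_bound_point (R : realType) (n : nat) (mu : {ffun 'S_n -> R}) (kap b : R)
    (A : {set 'S_n}) (s0 : 'S_n) (l : 'S_n -> 'I_n) :
  s0 \in A -> 0 < mu s0 -> exp_bound mu kap b [set s0] A l.
Proof.
move=> s0A mu0; have AE : A :&: [set s0] = [set s0].
  by apply/finset.setIidPr; rewrite finset.sub1set.
have hd : is_prob [set s0] [ffun y => (y == s0)%:R : R].
  by apply: is_prob_dirac; rewrite inE.
exists (fun=> [ffun y => (y == s0)%:R]) => [s|]; rewrite AE//.
rewrite divff ?ln1 ?mulr0 ?expR0 /meas !big_set1 ?gt_eqF// mulr1.
have m0 i : mismatch [ffun y => (y == s0)%:R : R] s0 i = 0.
  by apply: mismatch_eq0 hd _ => y; rewrite inE => /eqP ->.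
rewrite /cost m0 big1 => [|i _]; rewrite ?m0 expr0n//= addr0 mulr0 expR0.
by rewrite mulr1.
Qed.

(** * Induction on the number of free positions *)

Section Induction.

Variables (R : realType) (n M : nat) (mu : {ffun 'S_n -> R}) (a : R).
Hypotheses (ha : 0 < a < 1) (mu0 : forall s, 0 <= mu s).
Hypotheses (muV : forall s, mu (s^-1)%g = mu s) (muS : switchable M mu).

Let b := a / (1 - a).
Let kap := a / (2 * (2 * M%:R ^+ 2 + 2)).

Let b_gt0 : 0 < b.
Proof. by move: ha => /andP[a0 a1]; rewrite divr_gt0//; lra. Qed.

Let kap_gt0 : 0 < kap.
Proof.
have c0 : 0 < 2 * M%:R ^+ 2 + 2 :> R by have := sqr_ge0 (M%:R : R); lra.
by move: ha => /andP[a0 _]; rewrite divr_gt0// mulr_gt0.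
Qed.

Let meas_ge0 (A : {set 'S_n}) : 0 <= meas mu A.
Proof. exact: sumr_ge0. Qed.

Let meas_subset (A B : {set 'S_n}) : A \subset B -> meas mu A <= meas mu B.
Proof.
move=> AB; rewrite /meas [leRHS](big_setID A) /=.
by rewrite (finset.setIidPr AB) lerDl; exact: sumr_ge0.
Qed.

Let fiber (C : {set 'S_n}) (v i : 'I_n) : {set 'S_n} := [set s in C | s i == v].

Let in_fiber (C : {set 'S_n}) (v i : 'I_n) s : (s \in fiber C v i) = (s \in C) && (s i == v).
Proof. by rewrite inE. Qed.

Let fiber_cylinder (s0 s1 : 'S_n) (D : {set 'I_n}) (v i : 'I_n) :
  s1 \in fiber (cylinder s0 D) v i -> fiber (cylinder s0 D) v i = cylinder s1 (i |: D).
Proof.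
rewrite inE => /andP[/in_cylinder s1C /eqP s1i].
apply/finset.setP => s; rewrite inE; apply/andP/in_cylinder.
  move=> [/in_cylinder sC /eqP si] d; rewrite !inE => /predU1P[->|dD].
    by rewrite si.
  by rewrite sC// s1C.
move=> h; split; last by rewrite h ?finset.setU11 ?s1i.
by apply/in_cylinder => d dD; rewrite h ?s1C// !inE dD orbT.
Qed.

(** The fibre [k] keeps [q], a null fibre needs nothing, and any other fibre is compared with [k] by
    [switch_bound]. *)
Let fiber_bound (A : {set 'S_n}) (s0 : 'S_n) (D : {set 'I_n}) (v k : 'I_n)
    (q : 'S_n -> {ffun 'S_n -> R}) (P : R)
    (x := fun i => meas mu (A :&: fiber (cylinder s0 D) v i))
    (m := fun i => meas mu (fiber (cylinder s0 D) v i)) (i : 'I_n) :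
  0 < P -> P = x k / m k -> 0 < m k ->
  (forall j, x j / m j <= P) ->
  (forall j s1 l, s1 \in fiber (cylinder s0 D) v j -> 0 < mu s1 ->
    0 < x j -> exp_bound mu kap b (cylinder s1 (j |: D)) A (fun=> l)) ->
  (forall s, is_prob (A :&: fiber (cylinder s0 D) v k) (q s)) ->
  \sum_(s in fiber (cylinder s0 D) v k) mu s * expR (kap * cost (q s) s k)
    <= m k * expR (- b * ln P) ->
  exists p : 'S_n -> {ffun 'S_n -> R},
    (forall s, is_prob (A :&: cylinder s0 D) (p s)) /\
    \sum_(s in fiber (cylinder s0 D) v i) mu s * expR (kap * cost (p s) s i)
      <= expR (- b * ln P) * (m i + b * (m i - x i / P)).
Proof.
move=> P0 PE mk0 xP hx hq hqb.
have sub j : fiber (cylinder s0 D) v j \subset cylinder s0 D.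
  by apply/fintype.subsetP => s; rewrite inE => /andP[].
have qC s : is_prob (A :&: cylinder s0 D) (q s).
  by apply: is_prob_subset (hq s); apply: finset.setIS.
have [->|ik] := eqVneq i k.
  exists q; split=> //; apply: le_trans hqb _.
  have -> : x k / P = m k.
    rewrite PE; field; rewrite -?PE; apply/andP; split.
      by rewrite gt_eqF.
    by apply/eqP => xk0; move: P0; rewrite PE xk0 mul0r ltxx.
  by rewrite subrr mulr0 addr0 mulrC.
have [mi0|mi0] := ltP 0 (m i); last first.
  have mE : m i = 0 by apply/eqP; rewrite eq_le mi0 meas_ge0.
  have xE : x i = 0.
    apply/eqP; rewrite eq_le meas_ge0 -mE andbT.
    by apply: meas_subset; exact: finset.subsetIr.
  exists q; split=> //; rewrite mE xE mul0r subr0 mulr0 addr0 mulr0.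
  rewrite big1// => s sH; suff -> : mu s = 0 by rewrite mul0r.
  apply/eqP; rewrite eq_le mu0 andbT -mE /m /meas (bigD1 s)//= lerDl.
  exact: sumr_ge0.
have [s1 s1H s10] := meas_gt0P mu0 mi0.
have [s2 s2H s20] := meas_gt0P mu0 mk0.
have s12 : s2 \in cylinder s1 D.
  apply/in_cylinder => d dD; move: s1H s2H.
  rewrite !in_fiber => /andP[/in_cylinder s1C _] /andP[/in_cylinder s2C _].
  by rewrite s1C// s2C.
have e12 : s1 i = s2 k.
  by move: s1H s2H; rewrite !in_fiber => /andP[_ /eqP ->] /andP[_ /eqP ->].
have [g [r [gD gk gM r0 gmu]]] := muS s10 s20 s12 e12 ik.
have [||||p hp hpb] := @switch_bound R n M mu a A (fiber (cylinder s0 D) v i)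
   (fiber (cylinder s0 D) v k) q g i k v r P ha mu0 gk ik gM r0 _ _ _ mi0 P0 (xP i) _ hq hqb.
- by move=> s; rewrite inE => /andP[_ /eqP].
- move=> s; rewrite !in_fiber permM gk; congr (_ && _).
  by apply/in_cylinder/in_cylinder => h d dD; have := h d dD; rewrite permM gD.
- by move=> s sH; apply: gmu; rewrite -(fiber_cylinder s1H).
- by move=> xi0 l; rewrite (fiber_cylinder s1H); apply: hx.
exists p; split=> // s; apply: is_prob_subset (hp s); apply: finset.setIS.
by rewrite finset.subUset !sub.
Qed.

(** Splitting by the position of [v] prescribes one more value, and the bounds of [fiber_bound] add
    up. *)
Let exp_bound_step (A : {set 'S_n}) (s0 : 'S_n) (D : {set 'I_n}) (v : 'I_n) :
  0 < meas mu (A :&: cylinder s0 D) ->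
  (forall j s1 l, s1 \in fiber (cylinder s0 D) v j -> 0 < mu s1 ->
    0 < meas mu (A :&: cylinder s1 (j |: D)) ->
    exp_bound mu kap b (cylinder s1 (j |: D)) A (fun=> l)) ->
  exp_bound mu kap b (cylinder s0 D) A (fun s => (s^-1)%g v).
Proof.
set C := cylinder s0 D => AC0 hx.
pose x i := meas mu (A :&: fiber C v i); pose m i := meas mu (fiber C v i).
have fibE B : fiber B v =1 fun i => [set s in B | (s^-1)%g v == i].
  move=> i; apply/finset.setP => s; rewrite in_fiber inE; congr (_ && _).
  by rewrite eq_sym -(canF_eq (permKV s)) eq_sym.
have xS : \sum_i x i = meas mu (A :&: C).
  rewrite (meas_fibers mu (A :&: C) (fun s => (s^-1)%g v)); apply: eq_bigr => i _.
  rewrite /x fibE; congr meas.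
  by rewrite !finset.setIdE finset.setIA.
have mS : \sum_i m i = meas mu C.
  rewrite (meas_fibers mu C (fun s => (s^-1)%g v)); apply: eq_bigr => i _.
  by rewrite /m fibE.
have xm i : x i <= m i by apply: meas_subset; exact: finset.subsetIr.
(* [k] is the fibre of largest density; [v] merely witnesses that ['I_n] is inhabited. Null fibres
   have density 0, since division by 0 gives 0. *)
case: (@arg_maxP _ _ _ v predT (fun i => x i / m i) isT) => k _ kmax.
set P := x k / m k in kmax.
have P0 : 0 < P.
  have [i xi0] : exists i, 0 < x i.
    apply: contrapT => h; move: AC0; rewrite -xS big1 ?ltxx// => i _.
    apply/eqP; rewrite eq_le meas_ge0 andbT leNgt; apply/negP => xi0.
    by apply: h; exists i.
  apply: lt_le_trans (kmax i isT); rewrite divr_gt0//; exact: lt_le_trans (xm i).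
have mk0 : 0 < m k.
  rewrite lt_neqAle meas_ge0 andbT eq_sym; apply/eqP => mk.
  by move: P0; rewrite /P mk invr0 mulr0 ltxx.
have xk0 : 0 < x k by have := P0; rewrite /P pmulr_lgt0 ?invr_gt0.
have [s2 s2H s20] := meas_gt0P mu0 mk0.
have := hx k s2 k s2H s20; rewrite -(fiber_cylinder s2H) => /(_ xk0) [q hq hqb].
have /choice[p hp] : forall i, exists p : 'S_n -> {ffun 'S_n -> R},
    (forall s, is_prob (A :&: C) (p s)) /\
    \sum_(s in fiber C v i) mu s * expR (kap * cost (p s) s i)
      <= expR (- b * ln P) * (m i + b * (m i - x i / P)).
  move=> i; apply: (@fiber_bound A s0 D v k q P i P0 erefl mk0 (fun j => kmax j isT) _ hq hqb).
  by move=> j s1 l s1H s10 xj0; apply: (hx _ _ _ s1H s10); rewrite -(fiber_cylinder s1H).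
exists (fun s : 'S_n => p ((s^-1)%g v) s) => [s|]; first exact: (hp _).1.
rewrite (partition_big (fun s : 'S_n => (s^-1)%g v) predT)//=.
apply: (@le_trans _ _ (\sum_i expR (- b * ln P) * (m i + b * (m i - x i / P)))).
  apply: ler_sum => i _; apply: le_trans (hp i).2.
  rewrite le_eqVlt; apply/orP; left; apply/eqP; rewrite fibE.
  by apply: eq_big => s; rewrite ?inE// => /andP[_ /eqP ->].
rewrite -mulr_sumr big_split /= -mulr_sumr sumrB -mulr_suml xS mS.
set mC := meas mu C; set xC := meas mu (A :&: C).
have mC0 : 0 < mC by apply: (lt_le_trans AC0); apply: meas_subset; exact: finset.subsetIr.
have r0 : 0 < xC / mC / P by rewrite !divr_gt0.
have -> : ln (xC / mC) = ln P + ln (xC / mC / P).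
  by rewrite [in RHS]ln_div ?posrE ?divr_gt0// addrC subrK.
rewrite [- b * (_ + _)]mulrDr expRD [leRHS]mulrCA ler_wpM2l ?expR_ge0//.
have -> : mC + b * (mC - xC / P) = mC * (1 + b * (1 - xC / mC / P)).
  by field; rewrite !gt_eqF.
(* For [rho = xC / mC / P]: [1 + b * (1 - rho) <= 1 - b * ln rho <= expR (- b * ln rho)]. *)
rewrite ler_pM2l//; apply: le_trans (expR_ge1Dx _).
rewrite lerD2l mulNr -mulrN ler_pM2l// lerNr opprB.
have := expR_ge1Dx (ln (xC / mC / P)); rewrite lnK ?posrE//; lra.
Qed.

Lemma exp_bound_cylinder (d : nat) (A : {set 'S_n}) (s0 : 'S_n) (D : {set 'I_n})
    (v : 'I_n) :
  #|~: D| = d -> 0 < mu s0 -> 0 < meas mu (A :&: cylinder s0 D) ->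
  exp_bound mu kap b (cylinder s0 D) A (fun s => (s^-1)%g v).
Proof.
elim: d A s0 D v => [|d IH] A s0 D v cD mus0 AC0.
  have CE : cylinder s0 D = [set s0].
    apply/finset.setP => s; rewrite [RHS]inE; apply/in_cylinder/eqP => [h|-> //].
    apply/permP => i; apply: h; have : i \notin ~: D by rewrite (cards0_eq cD) inE.
    by rewrite inE negbK.
  rewrite CE; apply: exp_bound_point => //.
  have [s] := meas_gt0P mu0 AC0; by rewrite CE !inE => /andP[sA /eqP <-].
(* The induction hypothesis for the inverse sets gives the form with a fixed doubled position. *)
have IHpos A' s1 D' l : #|~: D'| = d -> 0 < mu s1 ->
    0 < meas mu (A' :&: cylinder s1 D') -> exp_bound mu kap b (cylinder s1 D') A' (fun=> l).
  move=> cD' s10 h.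
  have := IH (A'^-1)%g (s1^-1)%g (s1 @: D') l.
  rewrite -mem_cylinder_inv -invIg muV meas_invg// => IH'.
  have := exp_bound_inv muV (IH' _ s10 h); rewrite !invgK; apply.
  move: (cardsC D') (cardsC (s1 @: D')); rewrite card_imset; last exact: perm_inj.
  by rewrite cD' => <- /addnI.
have free w : (s0^-1)%g w \notin D ->
    exp_bound mu kap b (cylinder s0 D) A (fun s => (s^-1)%g w).
  move=> wD; apply: exp_bound_step => // j s1 l s1H s10; apply: IHpos => //.
  have jD : j \notin D.
    apply: contra wD => jD; move: s1H; rewrite inE => /andP[/in_cylinder h /eqP <-].
    by rewrite h// permK.
  apply: succn_inj; rewrite -cD (cardsD1 j (~: D)) !inE jD add1n.
  by rewrite finset.setCU finset.setIC -finset.setDE.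
have [vD|] := boolP ((s0^-1)%g v \in D); last exact: free.
(* [v] is already taken on [D], so its coordinate has no mismatch and the bound for the free value
   [s0 d0] is enough. *)
have [d0 d0D] : exists d0, d0 \in ~: D by apply/card_gt0P; rewrite cD.
have [|p hp hb] := free (s0 d0); first by rewrite permK -finset.in_setC.
exists p => //; apply: le_trans hb; apply: ler_sum => s sC.
rewrite ler_wpM2l// ler_expR ler_pM2l//.
rewrite lerD2l.
have sv : s ((s0^-1)%g v) = v by move/in_cylinder: sC => ->//; rewrite permKV.
have -> : (s^-1)%g v = (s0^-1)%g v by rewrite -{1}sv permK.
rewrite (mismatch_eq0 (hp s)) ?expr0n ?sqr_ge0// => y.
by rewrite finset.in_setI => /andP[_ /in_cylinder ->//]; rewrite sv permKV.
Qed.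

End Induction.

(** * Switchability of the uniform law on a local group *)

Lemma card_psuppD1 (n l : nat) (t : 'S_n) (i : 'I_n) :
  (pdeg t <= l)%N -> i \in psupp t -> (#|psupp t :\ i| <= l.-1)%N.
Proof.
rewrite /pdeg => tl it; move: tl; rewrite (cardsD1 i) it add1n => h.
by rewrite -ltnS (leq_trans h)// leqSpred.
Qed.

Lemma psupp_moved (n : nat) (t : 'S_n) (i j : 'I_n) :
  t i = j -> i != j -> j \in psupp t.
Proof.
move=> tij ij; rewrite inE; apply: contra ij => /eqP tj.
by apply/eqP; apply: (@perm_inj _ t); rewrite tij tj.
Qed.

Lemma card_psupp_conj (n : nat) (g h : 'S_n) (i : 'I_n) :
  #|psupp (h * g * h^-1)%g :\ (h^-1)%g i| = #|psupp g :\ i|.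
Proof.
rewrite -(card_imset (psupp g :\ i) (@perm_inj _ (h^-1)%g)).
apply: eq_card => x; rewrite -[x in RHS](permK h) mem_imset; last exact: perm_inj.
by rewrite !inE !permM [x == _]eq_sym !(canF_eq (permKV h)) [i == _]eq_sym.
Qed.

(** [(s2 * s1^-1)%g] sends [k] to [i] and fixes [D]. Locality replaces it by some [g] in [G] of
    small degree whose support is no larger, and translation by [g] preserves the uniform law. *)
Lemma switchable_uniform (R : realType) (n l : nat) (G : {group 'S_n}) :
  local_group l G -> switchable l.-1 (uniform_law R G).
Proof.
move=> Gl s1 s2 D i k; rewrite !ffunE.
case: ifP => [s1G _|]; last by rewrite ltxx.
case: ifP => [s2G _|]; last by rewrite ltxx.
move=> /in_cylinder s12 e12 ik.
have hG : (s2 * s1^-1)%g \in G by rewrite groupM ?groupV.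
have hk : (s2 * s1^-1)%g k = i by rewrite permM -e12 permK.
have [g gG [gs gl gk]] := Gl _ _ _ hG hk.
exists g, 1; split=> //.
- move=> d dD; apply/eqP; rewrite -[_ == _]negbK; apply/negP => gd.
  have : d \in psupp g by rewrite inE.
  by move/(fintype.subsetP gs); rewrite inE permM s12// permK eqxx.
- by apply: card_psuppD1 gl _; apply: psupp_moved gk _; rewrite eq_sym.
by move=> s _; rewrite !ffunE groupMl// mul1r.
Qed.

(** * Factorisation along a local base and switchability of [M_T] *)

Lemma rev_enum_base_idx_split (n : nat) (j : base_idx n) :
  exists p1 p2, [/\ rev (enum (base_idx n)) = p1 ++ j :: p2,
    forall j' : base_idx n, j' \in p1 -> (val j < val j')%N
  & forall j' : base_idx n, j' \in p2 -> (val j' < val j)%N].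
Proof.
have : j \in rev (enum (base_idx n)) by rewrite mem_rev mem_enum.
have : sorted (fun x y : base_idx n => (val y < val x)%N) (rev (enum (base_idx n))).
  have h : sorted ltn (map (@nat_of_ord n) (enum 'I_n)).
    by rewrite val_enum_ord iota_ltn_sorted.
  rewrite sorted_map in h.
  have tr : transitive (relpre (@nat_of_ord n) ltn) by move=> y x z; exact: ltn_trans.
  have := sorted_filter tr (fun j : 'I_n => (0 < j)%N) h.
  by rewrite -val_enum_base_idx sorted_map rev_sorted.
move=> + jr; case/splitPr: jr => p1 p2.
rewrite sorted_pairwise; last by move=> y x z /= h1 h2; exact: ltn_trans h2 h1.
rewrite pairwise_cat => /and3P[/allrelP h1 _].
rewrite pairwise_cons => /andP[/allP h2 _].
exists p1, p2; split=> // j' j'p.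
by apply: h1 => //; rewrite mem_head.
Qed.

Definition base_upper (n : nat) (t : base_idx n -> 'I_n -> 'S_n)
    (u : {ffun base_idx n -> 'I_n}) (j : 'I_n) : 'S_n :=
  (\prod_(j' <- rev (enum (base_idx n)) | (j < val j')%N) t j' (u j'))%g.

Definition base_lower (n : nat) (t : base_idx n -> 'I_n -> 'S_n)
    (u : {ffun base_idx n -> 'I_n}) (j : 'I_n) : 'S_n :=
  (\prod_(j' <- rev (enum (base_idx n)) | (val j' < j)%N) t j' (u j'))%g.

Lemma base_map_split (n : nat) (t : base_idx n -> 'I_n -> 'S_n)
    (u : {ffun base_idx n -> 'I_n}) (j : base_idx n) :
  base_map t u
    = (base_upper t u (val j) * t j (u j) * base_lower t u (val j))%g.
Proof.
have [p1 [p2 [e h1 h2]]] := rev_enum_base_idx_split j.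
rewrite /base_map /base_upper /base_lower e !big_cat !big_cons /= ltnn.
have -> : (\prod_(j' <- p2 | (val j < val j')%N) t j' (u j') = 1)%g.
  by rewrite big_seq_cond big1// => j' /andP[/h2/ltnW]; rewrite leqNgt => /negbTE ->.
have -> : (\prod_(j' <- p1 | (val j' < val j)%N) t j' (u j') = 1)%g.
  by rewrite big_seq_cond big1// => j' /andP[/h1/ltnW]; rewrite leqNgt => /negbTE ->.
rewrite mulg1 mul1g -mulgA; congr (_ * (_ * _))%g.
  rewrite big_seq [RHS]big_seq_cond; apply: eq_bigl => j'.
  by case: (boolP (j' \in p1)) => //= /h1 ->.
rewrite big_seq [RHS]big_seq_cond; apply: eq_bigl => j'.
by case: (boolP (j' \in p2)) => //= /h2 ->.
Qed.

(** Left multiplication by it replaces the factor [t j (u1 j)] by [t j (u2 j)] in any product with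
    upper part [base_upper t u1 (val j)]. *)
Definition switch_perm (n : nat) (t : base_idx n -> 'I_n -> 'S_n)
    (u1 u2 : {ffun base_idx n -> 'I_n}) (j : base_idx n) : 'S_n :=
  (base_upper t u1 (val j) * (t j (u2 j) * (t j (u1 j))^-1)
     * (base_upper t u1 (val j))^-1)%g.

Section BaseMeasure.

Variables (R : realType) (n l : nat) (G : {group 'S_n}).
Variables (t : base_idx n -> 'I_n -> 'S_n) (ht : local_base l G t).
Variables (nu : base_idx n -> {ffun 'I_n -> R}).
Hypothesis hnu : forall j, is_prob (orb G (val j)) (nu j).

Let mu : {ffun 'S_n -> R} := Defs.pushforward (base_map t) (product_law nu).

Let charged (u : {ffun base_idx n -> 'I_n}) : Prop := forall j, 0 < nu j (u j).

Let charged_base (u : {ffun base_idx n -> 'I_n}) (j : base_idx n) : charged u ->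
  [/\ forall k : 'I_n, (val j < k)%N -> t j (u j) k = k, t j (u j) (u j) = val j,
      (pdeg (t j (u j)) <= l)%N & u j = val j -> t j (u j) = 1%g].
Proof.
move=> hu; have uO : u j \in orb G (val j).
  case: (hnu j) => _ h _; rewrite -[_ \in _]negbK; apply/negP => /h e.
  by have := hu j; rewrite e ltxx.
have [t1 tO] := ht j; have [uj|uj] := eqVneq (u j) (val j).
  rewrite uj t1; split=> // [k _||]; rewrite ?perm1//.
  rewrite /pdeg (_ : psupp _ = finset.set0) ?cards0//.
  by apply/finset.setP => x; rewrite !inE perm1 eqxx.
have [+ -> tl] := tO _ uO uj; rewrite inE => /andP[_ /forallP h].
split=> // [k jk|e]; last by rewrite e eqxx in uj.
by have := h k; rewrite jk => /eqP.
Qed.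

Let lower_fix (u : {ffun base_idx n -> 'I_n}) (j k : 'I_n) :
  charged u -> (j <= k)%N -> base_lower t u j k = k.
Proof.
move=> hu jk; rewrite /base_lower.
apply: (big_ind (fun s : 'S_n => s k = k)) => [|x y hx hy|j' j'j].
- by rewrite perm1.
- by rewrite permM hx hy.
by case: (charged_base j' hu) => h _ _ _; exact: h (leq_trans j'j jk).
Qed.

Let eq_upper (u1 u2 : {ffun base_idx n -> 'I_n}) (j : 'I_n) :
  (forall j' : base_idx n, (j < val j')%N -> u1 j' = u2 j') -> base_upper t u1 j = base_upper t u2 j.
Proof. by move=> h; apply: eq_bigr => j' /h ->. Qed.

(** [t j (u j)] sends [u j] to [val j], which the lower factors fix; so a digit is read off the
    product and the digits above it. *)
Let upperE (u : {ffun base_idx n -> 'I_n}) (j : base_idx n) : charged u ->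
  base_upper t u (val j) (((base_map t u)^-1)%g (val j)) = u j.
Proof.
move=> hu; case: (charged_base j hu) => _ tj _ _.
have -> : ((base_map t u)^-1)%g (val j) = ((base_upper t u (val j))^-1)%g (u j).
  apply: (@perm_inj _ (base_map t u)).
  by rewrite permKV (base_map_split t u j) !permM permKV tj lower_fix.
by rewrite permKV.
Qed.

Let base_map_inj_above (u1 u2 : {ffun base_idx n -> 'I_n}) (j : nat) :
  charged u1 -> charged u2 ->
  (forall w : 'I_n, (j <= w)%N -> ((base_map t u1)^-1)%g w = ((base_map t u2)^-1)%g w) ->
  forall j' : base_idx n, (j <= val j')%N -> u1 j' = u2 j'.
Proof.
move=> h1 h2 hw j' jj'.
have [m] := ubnP (n - val j'); elim: m j' jj' => // m IH j' jj' hm.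
rewrite -(upperE j' h1) -(upperE j' h2) hw//; congr (fun_of_perm _ _).
apply: eq_upper => j'' j'j''; apply: IH; first exact: leq_trans jj' (ltnW j'j'').
by rewrite -ltnS; apply: leq_trans hm; rewrite ltnS ltn_sub2l.
Qed.

Let pos_charged (s : 'S_n) : 0 < mu s -> exists2 u, charged u & s = base_map t u.
Proof.
rewrite ffunE => h; apply: contrapT => hu; move: h.
rewrite big1 ?ltxx// => u /eqP us; rewrite ffunE; apply: contrapT => /eqP.
rewrite prodf_seq_neq0 => /allP hp; apply: hu; exists u => // j.
have := hp j (mem_index_enum _); rewrite /= lt_neqAle eq_sym => -> /=.
by case: (hnu j).
Qed.

(** By [base_map_inj_above] no other charged word has the same product. *)
Let mu_base_map (u : {ffun base_idx n -> 'I_n}) : charged u ->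
  mu (base_map t u) = \prod_j nu j (u j).
Proof.
move=> hu; rewrite ffunE (bigD1 u)//= ffunE [X in _ + X]big1 ?addr0// => u' /andP[/eqP e u'u].
rewrite ffunE; apply: contrapT => /eqP; rewrite prodf_seq_neq0 => /allP hp.
have hu' : charged u'.
  move=> j; have := hp j (mem_index_enum _); rewrite /= lt_neqAle eq_sym => -> /=.
  by case: (hnu j).
move/eqP: u'u; apply; apply/ffunP => j.
by apply: (base_map_inj_above hu' hu (j := val j)) => // w _; rewrite e.
Qed.

Let switch_perm_half (u1 u2 : {ffun base_idx n -> 'I_n}) (j : base_idx n) (s : 'S_n) :
  charged u1 -> charged u2 ->
  (forall w : 'I_n, (val j <= w)%N -> (s^-1)%g w = ((base_map t u1)^-1)%g w) ->
  0 < mu s ->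
  mu (switch_perm t u1 u2 j * s)%g = nu j (u2 j) / nu j (u1 j) * mu s.
Proof.
move=> h1 h2 hs /pos_charged[u hu sE]; rewrite {}sE in hs *.
have uE := base_map_inj_above hu h1 hs.
pose u' : {ffun base_idx n -> 'I_n} := [ffun j' => if j' == j then u2 j else u j'].
have hu' : charged u' by move=> j'; rewrite ffunE; case: eqP => [->|_].
have -> : (switch_perm t u1 u2 j * base_map t u)%g = base_map t u'.
  rewrite !(base_map_split t _ j) /switch_perm.
  have -> : base_upper t u' (val j) = base_upper t u1 (val j).
    apply: eq_upper => j' jj'; rewrite ffunE.
    by case: eqP => [e|_]; [rewrite e ltnn in jj'|exact: uE (ltnW jj')].
  have -> : base_upper t u (val j) = base_upper t u1 (val j).
    by apply: eq_upper => j' jj'; exact: uE (ltnW jj').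
  have -> : base_lower t u' (val j) = base_lower t u (val j).
    apply: eq_bigr => j' j'j; rewrite ffunE.
    by case: eqP => // e; rewrite e ltnn in j'j.
  by rewrite ffunE eqxx uE// !mulgA mulgKV mulgKV.
rewrite !mu_base_map// (bigD1 j)//= [in RHS](bigD1 j)//= ffunE eqxx uE// mulrA.
rewrite divfK ?gt_eqF//; congr (_ * _).
by apply: eq_bigr => j' /negbTE j'j; rewrite ffunE j'j.
Qed.

Let agree_above (u1 u2 : {ffun base_idx n -> 'I_n}) (j : base_idx n) : Prop :=
  forall w : 'I_n, (val j < w)%N ->
    ((base_map t u1)^-1)%g w = ((base_map t u2)^-1)%g w.

Let agree_upper (u1 u2 : {ffun base_idx n -> 'I_n}) (j : base_idx n) :
  charged u1 -> charged u2 -> agree_above u1 u2 j ->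
  base_upper t u1 (val j) = base_upper t u2 (val j).
Proof. by move=> h1 h2 h; apply: eq_upper => j'; apply: base_map_inj_above. Qed.

(** At [w = val j] this will give [g k = i]; above [val j] it will show that [g] fixes [D]. *)
Let switch_perm_above (u1 u2 : {ffun base_idx n -> 'I_n}) (j : base_idx n) (w : 'I_n) :
  charged u1 -> charged u2 -> agree_above u1 u2 j -> (val j <= w)%N ->
  switch_perm t u1 u2 j (((base_map t u2)^-1)%g w) = ((base_map t u1)^-1)%g w.
Proof.
move=> h1 h2 h jw; set y := ((base_map t u2)^-1)%g w.
have : base_map t u2 y = w by rewrite permKV.
rewrite (base_map_split t u2 j) -(agree_upper h1 h2 h) !permM.
rewrite -[w in _ = w -> _](lower_fix h2 jw) => /perm_inj yw.
apply: (@perm_inj _ (base_map t u1)); rewrite permKV.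
by rewrite (base_map_split t u1 j) /switch_perm !permM permKV permKV yw lower_fix.
Qed.

(** [switch_perm_half] covers positive masses. If [s] were null but its image charged, the reverse
    switch would give [s] positive mass. *)
Let switch_perm_law (u1 u2 : {ffun base_idx n -> 'I_n}) (j : base_idx n) (s : 'S_n) :
  charged u1 -> charged u2 -> agree_above u1 u2 j ->
  (forall w : 'I_n, (val j <= w)%N -> (s^-1)%g w = ((base_map t u1)^-1)%g w) ->
  mu (switch_perm t u1 u2 j * s)%g = nu j (u2 j) / nu j (u1 j) * mu s.
Proof.
move=> h1 h2 h hs.
have mu0 s' : 0 <= mu s'.
  rewrite ffunE; apply: sumr_ge0 => u _; rewrite ffunE; apply: prodr_ge0 => j' _.
  by case: (hnu j').
have [s0|s0] := ltP 0 (mu s); first exact: switch_perm_half.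
have {s0} s0 : mu s = 0 by apply/eqP; rewrite eq_le s0 mu0.
rewrite s0 mulr0; apply/eqP; rewrite eq_le mu0 andbT leNgt; apply/negP => gs0.
have hgs (w : 'I_n) : (val j <= w)%N ->
    ((switch_perm t u1 u2 j * s)^-1)%g w = ((base_map t u2)^-1)%g w.
  move=> jw; apply: (@perm_inj _ (switch_perm t u1 u2 j * s)%g).
  by rewrite permKV permM switch_perm_above// -hs// permKV.
have := switch_perm_half h2 h1 hgs gs0.
have -> : (switch_perm t u2 u1 j * (switch_perm t u1 u2 j * s))%g = s.
  by rewrite /switch_perm (agree_upper h1 h2 h) !mulgA !mulgKV mulgK mulgV mul1g.
rewrite s0 => /esym/eqP; rewrite mulf_eq0 [X in _ || X]gt_eqF// orbF.
by rewrite gt_eqF// divr_gt0.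
Qed.

(** After conjugation, a moved point other than [u1 j] lies in the support of [t j (u1 j)] minus
    [u1 j] or in that of [t j (u2 j)] minus [val j]. *)
Let card_psupp_switch_perm (u1 u2 : {ffun base_idx n -> 'I_n}) (j : base_idx n) :
  charged u1 -> charged u2 ->
  (#|psupp (switch_perm t u1 u2 j) :\ ((base_map t u1)^-1)%g (val j)| <= 2 * l.-1)%N.
Proof.
move=> h1 h2.
have -> : ((base_map t u1)^-1)%g (val j) = ((base_upper t u1 (val j))^-1)%g (u1 j).
  by rewrite -(upperE j h1) permK.
rewrite /switch_perm card_psupp_conj.
have [_ t1 l1 e1] := charged_base j h1; have [_ t2 l2 e2] := charged_base j h2.
have psupp1 : psupp (1%g : 'S_n) = finset.set0.
  by apply/finset.setP => x; rewrite !inE perm1 eqxx.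
have c1 : (#|psupp (t j (u1 j)) :\ u1 j| <= l.-1)%N.
  have [/e1 ->|ne] := eqVneq (u1 j) (val j); first by rewrite psupp1 finset.set0D cards0.
  by apply: card_psuppD1 l1 _; rewrite inE t1 eq_sym.
have c2 : (#|psupp (t j (u2 j)) :\ val j| <= l.-1)%N.
  have [/e2 ->|ne] := eqVneq (u2 j) (val j); first by rewrite psupp1 finset.set0D cards0.
  by apply: card_psuppD1 l2 _; exact: psupp_moved t2 ne.
rewrite mul2n -addnn; apply: leq_trans (leq_add c1 c2).
apply: leq_trans (leq_card_setU _ _); apply: subset_leq_card.
apply/fintype.subsetP => x; rewrite !inE permM => /andP[xu1 hx].
rewrite xu1 /=; have [//|] := boolP (t j (u1 j) x != x); rewrite negbK => /eqP t1x /=.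
apply/andP; split; last first.
  by apply: contra hx => /eqP ->; rewrite -{1}t1x permK.
apply: contra xu1 => /eqP xj.
by apply/eqP; apply: (@perm_inj _ (t j (u1 j))); rewrite t1 t1x.
Qed.

(** [pi] ranks the elements in a list that ends with [v] followed by [E]. *)
Let ordering_perm (E : {set 'I_n}) (v : 'I_n) : v \notin E ->
  exists pi : 'S_n, forall w : 'I_n, (pi v < w)%N = ((pi^-1)%g w \in E).
Proof.
move=> vE; pose F := enum (~: (v |: E)); pose r := F ++ v :: enum E.
have memr x : x \in r.
  by rewrite mem_cat inE !mem_enum !inE; case: (x == v) => //=; case: (x \in E).
have vF : v \notin F by rewrite mem_enum !inE eqxx.
have ur : uniq r.
  have vE' : v \notin enum E by rewrite mem_enum.
  rewrite cat_uniq cons_uniq !enum_uniq vE' /= (negbTE vF) /= andbT.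
  apply/hasPn => x; rewrite !mem_enum => xE.
  by rewrite !inE xE orbT.
have sr : size r = n.
  rewrite -[RHS]card_ord cardT; apply: perm_size; apply: uniq_perm => //.
    exact: enum_uniq.
  by move=> x; rewrite memr mem_enum.
have ltr x : (index x r < n)%N by rewrite -[X in (_ < X)%N]sr index_mem.
pose f x := Ordinal (ltr x).
have fI : injective f.
  by move=> x y /(congr1 val) /=; exact: (index_inj x (memr x) (memr y)).
exists (perm fI) => w; rewrite -[w in LHS](permKV (perm fI)).
move: (((perm fI)^-1)%g w) => x; rewrite !permE /= !index_cat (negbTE vF) /= eqxx addn0.
have [xF|xF] := boolP (x \in F).
  rewrite ltnNge (ltnW _) ?index_mem//.
  by move: xF; rewrite mem_enum !inE negb_or => /andP[_ /negbTE ->].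
rewrite /= eq_sym; case: eqP => [->|/eqP xv]; first by rewrite addn0 ltnn (negbTE vE).
rewrite addnS ltnS leq_addr.
by move: xF; rewrite mem_enum !inE negb_or (negbTE xv) /= negbK => ->.
Qed.

Lemma switchable_base_measure :
  (forall s r, mu (r^-1 * s * r)%g = mu s) -> switchable (2 * l.-1) mu.
Proof.
move=> muJ s1 s2 D i k s10 s20 /in_cylinder s12 e12 ik.
have iD : i \notin D.
  by apply: contra ik => iD; apply/eqP; apply: (@perm_inj _ s2); rewrite s12.
have kD : k \notin D.
  by apply: contra ik => kD; apply/eqP; apply: (@perm_inj _ s1); rewrite e12 s12.
have vE : s1 i \notin s1 @: D by rewrite mem_imset//; exact: perm_inj.
have [pi hpi] := ordering_perm vE.
(* Base indices exclude 0. Since [k] is neither [i] nor in [D], the value [s1 k] is ranked strictly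
   below [s1 i]. *)
have j0 : (0 < pi (s1 i))%N.
  rewrite lt0n; apply/eqP => j0.
  have : (pi (s1 i) < pi (s1 k))%N.
    rewrite j0 lt0n; apply/eqP => k0; move/eqP: ik; apply.
    by apply: (@perm_inj _ s1); apply: (@perm_inj _ pi); apply: val_inj; rewrite /= j0 k0.
  by rewrite hpi permK mem_imset ?(negbTE kD)//; exact: perm_inj.
pose j : base_idx n := exist _ (pi (s1 i)) j0.
pose c (s : 'S_n) := (pi^-1 * s * pi)%g.
have cV s x : ((c s)^-1)%g (pi x) = pi ((s^-1)%g x).
  by rewrite /c !invMg invgK !permM permK.
have [u1 h1 c1] := pos_charged (ltac:(by rewrite muJ) : 0 < mu (c s1)).
have [u2 h2 c2] := pos_charged (ltac:(by rewrite muJ) : 0 < mu (c s2)).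
have above (s : 'S_n) : {in D, s =1 s1} -> forall w : 'I_n, (val j < w)%N ->
    ((c s)^-1)%g w = ((c s1)^-1)%g w.
  move=> hs w; rewrite hpi => /imsetP[d dD e].
  have -> : w = pi (s1 d) by rewrite -e permKV.
  by rewrite !cV permK -[in LHS](hs d dD) permK.
have agr : agree_above u1 u2 j.
  by move=> w jw; rewrite -c1 -c2; apply/esym/above.
have iE : ((base_map t u1)^-1)%g (val j) = pi i by rewrite -c1 cV permK.
have kE : ((base_map t u2)^-1)%g (val j) = pi k by rewrite -c2 /= e12 cV permK.
pose g := switch_perm t u1 u2 j.
exists (pi * g * pi^-1)%g, (nu j (u2 j) / nu j (u1 j)); split.
- move=> d dD; rewrite 2!permM; apply: (canLR (permK pi)).
  have jd : (val j < pi (s1 d))%N by rewrite hpi permK imset_f.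
  have dE : pi d = ((base_map t u1)^-1)%g (pi (s1 d)) by rewrite -c1 cV permK.
  by rewrite [in LHS]dE agr// /g switch_perm_above ?(ltnW jd)// -dE.
- by rewrite 2!permM -kE /g switch_perm_above// iE permK.
- rewrite -[i](permK pi) card_psupp_conj -iE; exact: card_psupp_switch_perm.
- exact: divr_gt0.
move=> s /in_cylinder hs; rewrite -(muJ _ pi) -[in RHS](muJ _ pi).
have conjM (h : 'S_n) : (pi^-1 * (pi * h * pi^-1 * s) * pi = h * c s)%g.
  by rewrite /c !mulgA mulVg mul1g.
rewrite conjM.
apply: switch_perm_law => // w; rewrite leq_eqVlt => /orP[/eqP/val_inj <-|jw].
  have jE : val j = pi (s i) by rewrite hs ?finset.setU11.
  by rewrite iE jE cV permK.
by rewrite -c1; apply: above => // d dD; apply: hs; rewrite !inE dD orbT.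
Qed.

End BaseMeasure.

(** * From kernels to concentration *)

(** The cylinder with no prescribed value is all of [S_n], of mass 1. *)
Lemma exp_bound_cost (R : realType) (n M : nat) (mu : {ffun 'S_n -> R}) (a : R)
    (A : {set 'S_n}) (v : 'I_n) :
  0 < a < 1 -> is_prob [set: 'S_n] mu -> (forall s, mu (s^-1)%g = mu s) ->
  switchable M mu -> 0 < meas mu A ->
  exists2 p : 'S_n -> {ffun 'S_n -> R}, forall s, is_prob A (p s)
  & \sum_s mu s * expR (a / (2 * (2 * M%:R ^+ 2 + 2)) * cost (p s) s ((s^-1)%g v))
      <= (meas mu A `^ (a / (1 - a)))^-1.
Proof.
move=> ha [mu0 _ mu1] muV muS A0.
have [s0 _ s00] := meas_gt0P mu0 A0.
have CT : cylinder s0 finset.set0 = finset.setT.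
  by apply/finset.setP => s; rewrite [RHS]inE; apply/in_cylinder => i; rewrite inE.
have := @exp_bound_cylinder R n M mu a ha mu0 muV muS _ A s0 finset.set0 v erefl s00.
rewrite CT finset.setIT => /(_ A0) [p hp hb]; exists p => [s|].
  by have := hp s; rewrite finset.setIT.
have mT : meas mu [set: 'S_n] = 1 by rewrite -mu1; apply: eq_bigl => s; rewrite inE.
move: hb; rewrite finset.setIT mT divr1 mul1r mulNr expRN /powR gt_eqF//.
by apply: le_trans; rewrite le_eqVlt; apply/orP; left; apply/eqP; apply: eq_bigl => s; rewrite inE.
Qed.

Lemma talagrand_le_cost (R : realType) (n : nat) (A : {set 'S_n})
    (p : {ffun 'S_n -> R}) (s : 'S_n) (l : 'I_n) :
  is_prob A p -> (talagrand R s A <= (cost p s l)%:E)%E.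
Proof.
move=> hp; pose x := \sum_(y in A) p y *: diff_vec R s y.
apply: (@le_trans _ _ (sqnorm2 x)%:E).
  by apply: ereal_inf_lbound; exists x => //; exists p.
rewrite lee_fin /cost; have -> : sqnorm2 x = \sum_i mismatch p s i ^+ 2.
  apply: eq_bigr => i _; congr (_ ^+ 2); rewrite /x summxE big_mkcond /=.
  apply: eq_bigr => y _; rewrite !mxE; case: ifP => // /negbT yA.
  by case: hp => _ -> //; rewrite mul0r.
by rewrite lerDl sqr_ge0.
Qed.

Lemma talagrand_concentration (R : realType) (n M : nat) (G : {group 'S_n})
    (mu : {ffun 'S_n -> R}) (c2 : R) :
  (0 < n)%N -> is_prob G mu -> (forall s, mu (s^-1)%g = mu s) ->
  switchable M mu -> c2 = 2 * M%:R ^+ 2 + 2 ->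
  (forall (A : {set 'S_n}) (alpha : R), A \subset G -> 0 < alpha < 1 ->
     (\sum_(s in G) expeR ((alpha / (2 * c2))%:E * talagrand R s A) * (mu s)%:E
        <= ((meas mu A `^ (alpha / (1 - alpha)))%:E)^-1)%E)
  /\
  (forall (A : {set 'S_n}) (alpha x : R), A \subset G -> 0 < alpha < 1 ->
     0 <= x ->
     ((meas mu [set s in G | (x%:E <= talagrand R s A)%E])%:E
        <= (expR (- (alpha * x / (2 * c2))))%:E
             / (meas mu A `^ (alpha / (1 - alpha)))%:E)%E).
Proof.
move=> n0 hmu muV muS c2E; have [mu0 _ mu1] := hmu.
have hmuT : is_prob [set: 'S_n] mu by apply: is_prob_subset hmu; exact: finset.subsetT.
pose v := Ordinal n0.
have c20 : 0 < c2 by rewrite c2E; have := sqr_ge0 (M%:R : R); lra.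
have inv0 (A : {set 'S_n}) (a : R) : 0 < a < 1 -> meas mu A <= 0 ->
    ((meas mu A `^ (a / (1 - a)))%:E)^-1%E = +oo%E.
  move=> /andP[a0 a1] mA; have -> : meas mu A = 0.
    by apply/eqP; rewrite eq_le mA; apply: sumr_ge0.
  rewrite powR0 ?inve0//; apply: lt0r_neq0; rewrite divr_gt0//; lra.
have invE (A : {set 'S_n}) (a : R) : 0 < meas mu A ->
    ((meas mu A `^ (a / (1 - a)))%:E)^-1%E = ((meas mu A `^ (a / (1 - a)))^-1)%:E.
  by move=> A0; rewrite inver gt_eqF// powR_gt0.
split=> [A a AG ha|A a x AG ha x0]; have [A0|A0] := ltP 0 (meas mu A).
- have [p hp] := exp_bound_cost v ha hmuT muV muS A0; rewrite -c2E => hb.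
  have a0 : 0 < a by case/andP: ha.
  rewrite invE//; apply: (@le_trans _ _ (\sum_(s in G)
      (mu s * expR (a / (2 * c2) * cost (p s) s ((s^-1)%g v)))%:E)%E).
    apply: lee_sum => s _; rewrite [leRHS]EFinM [leLHS]muleC; apply: lee_wpmul2l.
      by rewrite lee_fin.
    rewrite -[leRHS]/(expeR (_)%:E) lee_expeR [leRHS]EFinM; apply: lee_wpmul2l.
      by rewrite lee_fin divr_ge0 ?mulr_ge0// ltW.
    exact: talagrand_le_cost.
  rewrite sumEFin lee_fin; apply: le_trans hb.
  rewrite [leLHS]big_mkcond; apply: ler_sum => s _; case: ifP => // _.
  by rewrite mulr_ge0 ?expR_ge0.
- by rewrite inv0// leey.
- have [p hp] := exp_bound_cost v ha hmuT muV muS A0; rewrite -c2E => hb.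
  have a0 : 0 < a by case/andP: ha.
  rewrite invE// -EFinM lee_fin.
  (* Markov's inequality, with the cost in place of [talagrand]. *)
  apply: le_trans (ler_wpM2l (expR_ge0 _) hb).
  rewrite mulr_sumr /meas [leLHS]big_mkcond; apply: ler_sum => s _.
  case: ifP => [|_]; last by rewrite !mulr_ge0 ?expR_ge0.
  rewrite inE => /andP[_ xs]; rewrite mulrCA -expRD ler_peMr// -expR0 ler_expR.
  have := le_trans xs (talagrand_le_cost s ((s^-1)%g v) (hp s)); rewrite lee_fin => xc.
  rewrite addrC subr_ge0 mulrAC ler_wpM2l// divr_ge0 ?mulr_ge0// ltW//.
by rewrite inv0// gt0_muley ?leey// lte_fin expR_gt0.
Qed.

(* [c2] is c(l)^2. Inverses are taken in \bar R, where 0^-1 = +oo.             *)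
Theorem corollary1p1 (R : realType) (n l : nat) (G : {group 'S_n})
    (t : base_idx n -> 'I_n -> 'S_n) (mu : {ffun 'S_n -> R}) (c2 : R)
    (hn : (2 <= n)%N) (hl : (2 <= l <= n)%N)
    (ht : local_base l G t)
    (hmu : is_prob G mu) (hM : base_measure G t mu)
    (hc : (local_group l G /\ mu = uniform_law R G /\
             c2 = 2 * (l%:R - 1) ^+ 2 + 2)
       \/ (normal G [set: 'S_n] /\
             (forall s : 'S_n, s \in G -> mu s = mu (s^-1)%g) /\
             (forall s r : 'S_n, s \in G -> mu s = mu (r^-1 * s * r)%g) /\
             c2 = 8 * (l%:R - 1) ^+ 2 + 2)) :
  (forall (A : {set 'S_n}) (alpha : R), A \subset G -> 0 < alpha < 1 ->
     (\sum_(s in G) expeR ((alpha / (2 * c2))%:E * talagrand R s A) * (mu s)%:E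
        <= ((meas mu A `^ (alpha / (1 - alpha)))%:E)^-1)%E)
  /\
  (forall (A : {set 'S_n}) (alpha x : R), A \subset G -> 0 < alpha < 1 ->
     0 <= x ->
     ((meas mu [set s in G | (x%:E <= talagrand R s A)%E])%:E
        <= (expR (- (alpha * x / (2 * c2))))%:E
             / (meas mu A `^ (alpha / (1 - alpha)))%:E)%E).
Proof.
have mu0 s : s \notin G -> mu s = 0 by case: hmu => _ h _; exact: h.
have n0 : (0 < n)%N by exact: leq_trans hn.
case: hc => [[Gl [muE c2E]]|[Gn [muV [muJ c2E]]]].
  apply: (talagrand_concentration n0 hmu (M := l.-1)).
  - by move=> s; rewrite muE !ffunE groupV.
  - by rewrite muE; exact: switchable_uniform.
  by rewrite c2E -subn1 natrB//; case/andP: hl => /ltnW.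
apply: (talagrand_concentration n0 hmu (M := 2 * l.-1)).
- move=> s; have [/muV -> //|sG] := boolP (s \in G).
  by rewrite !mu0 ?groupV.
- case: hM => nu hnu mE; rewrite mE; apply: (switchable_base_measure ht hnu).
  (* Off [G] both masses vanish, because [G] is stable under conjugation. *)
  rewrite -mE => s r; have [/(muJ _ r) -> //|sG] := boolP (s \in G).
  rewrite !mu0// -mulgA -/(conjg s r) memJ_norm//.
  by apply: (fintype.subsetP (normal_norm Gn)); rewrite inE.
(* With [M = 2 * (l - 1)], the constant [2 * M ^+ 2 + 2] is [8 * (l - 1) ^+ 2 + 2]. *)
rewrite c2E natrM -subn1 natrB; first by ring.
by case/andP: hl => /ltnW.
Qed.
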